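(* Let $k\ge1$, $n_0\ge0$ be integers, $0<\alpha\le1$, and let $\lambda_{(n)_i}>0$ ($n\ge n_0$, $1\le i\le k$). Let $p^{\alpha}(n,t)$, $n\ge n_0$, be the state probabilities of the generalized fractional birth process with these rates. Then $$p^{\alpha}(n_0,t)=E_{\alpha,1}\left(-\sum_{i=1}^{k}\lambda_{(n_0)_i}t^{\alpha}\right),$$ and for every $m\ge1$ $$p^{\alpha}(n_0+m,t)=\sum_{(x_1,\dots,x_m)\in\Theta}\ \prod_{j=0}^{m-1}\lambda_{(n_0+j)_{x_{j+1}}}\ \frac{(-1)^{m^*-1}}{\prod_{l=2}^{m^*}\mu_l}\sum_{i=m^*-1}^{\infty}\frac{(-t^{\alpha})^{i}}{\Gamma(i\alpha+1)}\sum_{(y_1,\dots,y_{m^*})\in\Omega^{i}_{m^*}}\ \prod_{l=1}^{m^*}\mu_l^{y_l},$$ where $\Theta=\Theta_m^{k}$ if $1\le k\le m-1$ and $\Theta=\Theta_m^{m}$ if $k\ge m$, and where, for each tuple $(x_1,\dots,x_m)$, $m^*=|\Lambda_m|$ and $\mu_l=\sum_{i=1}^{k}\lambda_{(n_0+(j)_l)_i}$, $1\le l\le m^*$. If moreover, for each tuple $(x_1,\dots,x_m)\in\Theta$, the numbers $\mu_1,\dots,\mu_{m^*}$ are distinct, then $$p^{\alpha}(n_0+m,t)=\sum_{(x_1,\dots,x_m)\in\Theta}\ \prod_{j=0}^{m-1}\lambda_{(n_0+j)_{x_{j+1}}}\ \sum_{i=1}^{m^*}\frac{E_{\alpha,1}(-\mu_i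 t^{\alpha})}{\prod_{l=1,\,l\ne i}^{m^*}(\mu_l-\mu_i)},$$ with the same $\Theta$.
   Context: Caputo derivative: for $0<\alpha<1$, $\frac{\mathrm{d}^{\alpha}}{\mathrm{d}t^{\alpha}}f(t)=\frac{1}{\Gamma(1-\alpha)}\int_0^t(t-s)^{-\alpha}f'(s)\,\mathrm{d}s$; for $\alpha=1$ it is $f'(t)$. Mittag-Leffler function: $E_{\alpha,1}(x)=\sum_{j=0}^{\infty}\frac{x^j}{\Gamma(j\alpha+1)}$. The generalized fractional birth process (GFBP) $\{\mathcal{X}^{\alpha}(t)\}_{t\ge0}$ is the process whose state probabilities $p^{\alpha}(n,t)=\mathrm{Pr}\{\mathcal{X}^{\alpha}(t)=n\}$ satisfy $$\frac{\mathrm{d}^{\alpha}}{\mathrm{d}t^{\alpha}}p^{\alpha}(n,t)=-\sum_{i=1}^{k}\lambda_{(n)_i}p^{\alpha}(n,t)+\sum_{i=1}^{\min\{n,k\}}\lambda_{(n-i)_i}p^{\alpha}(n-i,t),\quad n\ge n_0,$$ with $p^{\alpha}(n_0,0)=1$, $p^{\alpha}(n,0)=0$ for $n>n_0$, and $p^{\alpha}(n,t)=0$ for $n<n_0$. The sets $\Theta_n^k\subset\mathbb{R}^n$ ($n,k\ge1$): let $\bar e_n^{\,j}$ be the $n$-tuple unit row vector with $1$ at the $j$th place and $0$ elsewhere, and for $m>n$ let $Q_{n\times m}=[\,I_{n\times n}\ \ O_{n\times(m-n)}\,]$ (identity block followed by zero block), so that $\bar x\mapsto\bar xQ_{n\times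 m}$ appends $m-n$ zeros to $\bar x$. For a set $A$ of row vectors, $AQ+v=\{\bar xQ+v:\bar x\in A\}$. Then $\Theta_1^k=\{(1)\}$ for all $k\ge1$, and for $n\ge2$ $$\Theta_n^k=\begin{cases}\bigcup_{i=1}^{k}\left\{\Theta_{n-i}^{k}Q_{(n-i)\times n}+i\,\bar e_n^{\,n-i+1}\right\}, & 1\le k\le n-1,\\[1ex]\bigcup_{i=1}^{n-1}\left\{\Theta_{n-i}^{n}Q_{(n-i)\times n}+i\,\bar e_n^{\,n-i+1}\right\}\cup\{n\,\bar e_n^{\,1}\}, & k\ge n.\end{cases}$$ For $(x_1,\dots,x_n)\in\Theta_n^k$, $\Lambda_n=\{0,1,\dots,n\}\setminus\{1\le j\le n-1:\ x_{j+1}=0\}$, $n^*=|\Lambda_n|$, and $(j)_1<(j)_2<\dots<(j)_{n^*}$ are the elements of $\Lambda_n$ in increasing order, i.e. $(j)_1=0$, $(j)_l=\inf\{(j)_{l-1}<j\le n-1:\ x_{j+1}\ne0\}$ for $1<l<n^*$, and $(j)_{n^*}=n$. All of these depend on the tuple. Convention: $\lambda_{(n)_0}=1$ for all $n\ge n_0$. Finally, with $\mathbb{N}_0$ the non-negative integers, $$\Omega^{i}_{n}=\Big\{(y_1,\dots,y_n):\ \sum_{j=1}^{n}y_j=i,\ y_1\in\mathbb{N}_0,\ y_j\in\mathbb{N}_0\setminus\{0\}\text{ for }2\le j\le n\Big\}.$$ *)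

(* Defs.v *)
From HB Require Import structures.
From mathcomp Require Import all_boot all_order all_algebra.
From mathcomp Require Import all_classical all_reals all_analysis.
Set Implicit Arguments.
Unset Strict Implicit.
Unset Printing Implicit Defensive.
Import Order.TTheory GRing.Theory Num.Theory.
Import numFieldNormedType.Exports.
Local Open Scope classical_set_scope.
Local Open Scope ring_scope.

Definition Gamma (R : realType) (z : R) : R :=
  Rintegral (@lebesgue_measure R) `]0, +oo[
    (fun u => u `^ (z - 1) * expR (- u)).

(* E_{a,1}(x) *)
Definition mittag_leffler (R : realType) (a x : R) : R :=
  limn (series (fun j : nat => x ^+ j / Gamma (j%:R * a + 1))).

(* The Caputo derivative of order 0 < a <= 1, with base point 0.  Only the
   values of f on [0, +oo[ matter. *)
Definition caputo (R : realType) (a : R) (f : R -> R) (t : R) : R :=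
  if a == 1 then derive1 f t
  else (Gamma (1 - a))^-1 *
    Rintegral (@lebesgue_measure R) `]0, t[
      (fun s => (t - s) `^ (- a) * derive1 f s).

(* [caputo] is a total operator; it is the Caputo derivative of f on ]0, +oo[
   when f is continuous on [0, +oo[, differentiable on ]0, +oo[ and, for
   a != 1, the integral converges.  f need not be differentiable at 0
   (t |-> E_{a,1}(- c t^a) is not, for a < 1). *)
Definition caputo_derivable (R : realType) (a : R) (f : R -> R) : Prop :=
  [/\ f t @[t --> 0^'+] --> f 0,
      forall t : R, 0 < t -> derivable f t 1 &
      a != 1 -> forall t : R, 0 < t ->
        (@lebesgue_measure R).-integrable `]0, t[
          (fun s => ((t - s) `^ (- a) * derive1 f s)%:E)].

(* The process takes its values in N together with a cemetery state [None],
   since for arbitrary positive rates it may explode in finite time and the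
   state probabilities on N may then sum up to less than 1.  An N-valued
   process is the case where [None] is never reached. *)
Definition state_prob (R : realType) (d : measure_display)
    (T : measurableType d) (P : probability T R) (X : R -> T -> option nat)
    (n : nat) (t : R) : R :=
  fine (P (X t @^-1` [set Some n])).

(* [lam n i] is the rate lambda_{(n)_i} of a jump of size i from state n. *)
Definition is_GFBP (R : realType) (d : measure_display) (T : measurableType d)
    (P : probability T R) (k n0 : nat) (a : R) (lam : nat -> nat -> R)
    (X : R -> T -> option nat) : Prop :=
  let p := state_prob P X in
  [/\ forall (t : R) n, 0 <= t -> measurable (X t @^-1` [set Some n]),
      forall n, (n0 <= n)%N -> caputo_derivable a (p n),
      forall n (t : R), (n0 <= n)%N -> 0 < t ->
        caputo a (p n) t =
          - (\sum_(1 <= i < k.+1) lam n i) * p n t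
          + \sum_(1 <= i < (minn n k).+1) lam (n - i)%N i * p (n - i)%N t,
      p n0 0 = 1 /\ (forall n, (n0 < n)%N -> p n 0 = 0) &
      forall n (t : R), (n < n0)%N -> 0 <= t -> p n t = 0].

(* The row vector of size n with a 1 at the j-th place, counted from 1. *)
Definition unit_row (n j : nat) : 'rV[nat]_n := \row_(l < n) (l.+1 == j : nat).

(* [pid_mx n : 'M_(n, m)] is the block matrix [I O] when n < m. *)
Inductive Theta : forall n : nat, nat -> set 'rV[nat]_n :=
| Theta_one k : (1 <= k)%N -> @Theta 1 k (const_mx 1%N)
| Theta_lt n k i (x : 'rV[nat]_(n - i)) :
    (2 <= n)%N -> (1 <= k <= n.-1)%N -> (1 <= i <= k)%N ->
    @Theta (n - i) k x ->
    @Theta n k (x *m pid_mx (n - i) + unit_row n (n - i).+1 *+ i)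
| Theta_ge n k i (x : 'rV[nat]_(n - i)) :
    (2 <= n)%N -> (n <= k)%N -> (1 <= i <= n.-1)%N ->
    @Theta (n - i) n x ->
    @Theta n k (x *m pid_mx (n - i) + unit_row n (n - i).+1 *+ i)
| Theta_top n k :
    (2 <= n)%N -> (n <= k)%N -> @Theta n k (unit_row n 1 *+ n).

Arguments Theta n k : clear implicits.

Definition Theta_range (m k : nat) : set 'rV[nat]_m :=
  if (k <= m.-1)%N then Theta m k else Theta m m.

Arguments Theta_range m k : clear implicits.

(* {0, ..., n} \ {1 <= j <= n - 1 : x_{j+1} = 0}; the component x_{j+1}, counted
   from 1, is [x 0 j] with j : 'I_n. *)
Definition Lambda (n : nat) (x : 'rV[nat]_n) : {set 'I_n.+1} :=
  [set: 'I_n.+1] :\: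
  [set widen_ord (leqnSn n) j | j : 'I_n & (0 < j)%N && (x 0 j == 0%N)].

(* [enum_val] lists the elements of Lambda x increasingly: (j)_{l+1} is
   [enum_val l] for l : 'I_#|Lambda x|, so that [mu lam k n0 l] is mu_{l+1}. *)
Definition mu (R : realType) (lam : nat -> nat -> R) (k n0 m : nat)
    (x : 'rV[nat]_m) (l : 'I_#|Lambda x|) : R :=
  \sum_(1 <= i < k.+1) lam (n0 + enum_val l)%N i.

Definition Omega (n i : nat) : set 'rV[nat]_n :=
  [set y : 'rV[nat]_n | (\sum_(j < n) y ord0 j)%N = i /\
           forall j : 'I_n, (0 < j)%N -> (0 < y ord0 j)%N].

Arguments Omega n i : clear implicits.

(* The i-th term of the series in t attached to the tuple x. *)
Definition series_term (R : realType) (a : R) (lam : nat -> nat -> R)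
    (k n0 m : nat) (x : 'rV[nat]_m) (t : R) (i : nat) : R :=
  (- (t `^ a)) ^+ i / Gamma (i%:R * a + 1) *
  \sum_(y \in Omega #|Lambda x| i)
     \prod_(l < #|Lambda x|) mu lam k n0 l ^+ y 0 l.

(* Main.v *)
Require Import Defs.
From HB Require Import structures.
From mathcomp Require Import all_boot all_order all_algebra.
From mathcomp Require Import all_classical all_reals all_analysis.
From mathcomp Require Import measurable_realfun ring lra zify.
Set Implicit Arguments.
Unset Strict Implicit.
Unset Printing Implicit Defensive.
Import Order.TTheory GRing.Theory Num.Theory.
Import numFieldNormedType.Exports.
Local Open Scope classical_set_scope.
Local Open Scope ring_scope.

(** Write I for the fractional integral of order a.  Applied to the defining
    system it gives the Volterra equations
      p_m (t) = [m = 0] + I (sum_(j <= m) A_(m, j) p_j) (t),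
    where p_m is the probability of being m steps above the initial state, and
    A is lower triangular: minus the total rate on the diagonal, the rate of
    the jump from j to m below it.  Since I maps t^(a i) / Gamma (a i + 1) to
    t^(a (i + 1)) / Gamma (a (i + 1) + 1), unrolling the equations N times
    expands p_m into the first N terms of
      sum_i (A^i e_0)_m t^(a i) / Gamma (a i + 1).
    What remains is an N-fold fractional integral of the p_j.  These are
    probabilities, hence bounded by 1, so the remainder is at most
    K^N t^(a N) / Gamma (a N + 1), which tends to 0 as Gamma outgrows every
    geometric sequence.  Thus the equations force the expansion
    (system_power_series_cvg).

    The passage to the Volterra equations (caputo_volterra) is the analytic
    core.  That I inverts the Caputo derivative follows from Fubini's theorem
    and the Beta integral, but only up to the identity between f t - f 0 and
    the integral of f'.  Here f' exists at every point and is integrable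
    without being known to be continuous, so this identity is the fundamental
    theorem of calculus in its Lebesgue form (integral_derive1), obtained from
    an upper approximation of f' that is locally bounded below near each point
    (vitali_caratheodory).

    The rest is algebra.  The coefficient (A^i e_0)_m is a sum over the paths
    from 0 to m (path_sum), and the tuples in Theta encode exactly these paths
    (Theta_rangeE): the component x_(j+1) is the size of the jump made from
    state j, or 0 when j is skipped.  A path through states with total rates
    mu_1, ..., mu_r contributes the product of its jump rates times
      (-1)^(i - r + 1) h_(i - r + 1) (mu_1, ..., mu_r),
    with h the complete homogeneous symmetric polynomial.  The sum over Omega
    is mu_2 ... mu_r times this polynomial (hcoefE); for distinct rates the
    polynomial is a divided difference of a power, sum_l (- mu_l)^i /
    prod_(p != l) (mu_p - mu_l) (hcoef_divided_difference), which resums to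
    Mittag-Leffler functions. *)

(** * The fundamental theorem of calculus for integrable derivatives *)
Section ftc.
Variable R : realType.
Notation mu := (@lebesgue_measure R).

Lemma cvg_le_of_near (F : set_system R) (PF : ProperFilter F) (f : R -> R) (l c : R) :
  f y @[y --> F] --> l -> (\forall y \near F, f y <= c) -> l <= c.
Proof.
move=> fl fc; rewrite -(cvg_lim _ fl)//.
by apply: limr_le => //; apply/cvg_ex; exists l.
Qed.

Lemma itv_bounded_integrable (h : R -> R) (a b M : R) :
  measurable_fun `]a, b[ h -> (forall x, x \in `]a, b[ -> `|h x| <= M) ->
  mu.-integrable `]a, b[ (EFin \o h).
Proof.
move=> mh hM; apply: measurable_bounded_integrable => //.
- rewrite [X in (X < _)%E]lebesgue_measure_itv/=.
  by case: ifP => _; rewrite -?EFinB ltry.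
- rewrite /bounded_near; near=> N => x /= xab.
  by apply: (le_trans (hM x xab)); near: N; apply: nbhs_pinfty_ge; exact: num_real.
Unshelve. all: by end_near. Qed.

(** Continuous induction from the left end: the set where the inequality holds
    is closed under suprema.  Monotonicity of [U] replaces its continuity, so
    that [U] may be the integral of an unbounded function. *)
Lemma increment_le_of_local (f U : R -> R) (a b : R) : a < b ->
  (forall x, a < x -> x <= b -> f y @[y --> x^'-] --> f x) ->
  f y @[y --> a^'+] --> f a ->
  (forall x y, a <= x -> x <= y -> y <= b -> U x <= U y) ->
  (forall x, a < x < b -> \forall y \near x^'+, f y - f x <= U y - U x) ->
  f b - f a <= U b - U a.
Proof.
move=> ab fl fa ndU loc.
suff key c : a < c < b -> f b - f c <= U b - U a.
  have : (f b - f c) @[c --> a^'+] --> f b - f a.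
    by apply: cvgB => //; exact: cvg_cst.
  move=> /cvg_le_of_near; apply; near=> c; apply: key.
  by apply/andP; split; near: c; [exact: nbhs_right_gt|exact: nbhs_right_lt].
move=> /andP[ac cb].
pose S := [set y | c <= y <= b /\ f y - f c <= U y - U c].
have Sc : S c by split; rewrite ?lexx ?(ltW cb)// !subrr.
have supS : has_sup S.
  by split; [exists c | exists b => y [] /andP[]].
pose s := sup S.
have cs : c <= s by apply: ub_le_sup => //; case: supS.
have sb : s <= b by apply: ge_sup => [|y [] /andP[]//]; exists c.
have Ss : f s - f c <= U s - U c.
  move: cs; rewrite le_eqVlt => /predU1P[<-|cs]; first by rewrite !subrr.
  have ps : f y - f c @[y --> s^'-] --> f s - f c.
    by apply: cvgB; [apply: fl => //; exact: lt_trans cs | exact: cvg_cst].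
  rewrite leNgt; apply/negP => ltU.
  have [e /= e0 He] := cvgr_gt _ ps _ ltU.
  have [y [/andP[cy yb] Sy] sey] := sup_adherent e0 supS.
  have ys : y <= s by apply: ub_le_sup; [case: supS|split=> //; apply/andP].
  move: ys; rewrite le_eqVlt => /predU1P[ys|ys].
    by move: ltU; rewrite -ys ltNge Sy.
  have := He y; rewrite /= gtr0_norm ?subr_gt0// ltrBlDr -ltrBlDl.
  move=> /(_ sey ys).
  rewrite ltNge => /negP; apply.
  by rewrite (le_trans Sy)// lerB// ndU// ?(le_trans (ltW ac))// ltW.
have [sb'|] := ltP s b; last first.
  move=> bs; have {}bs : s = b by apply/eqP; rewrite eq_le sb.
  rewrite -bs; apply: (le_trans Ss); rewrite lerB// ndU// ltW//.
exfalso.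
have as_ : a < s < b by rewrite (lt_le_trans ac cs) sb'.
have [e /= e0 He] := loc _ as_.
have m0 : 0 < Num.min (e / 2) (b - s) by rewrite lt_min divr_gt0// subr_gt0.
pose y := s + Num.min (e / 2) (b - s).
have sy : s < y by rewrite ltrDl.
have yb : y <= b by rewrite -lerBrDl ge_min lexx orbT.
have Hy := He y.
have : S y.
  split; first by rewrite yb (le_trans cs (ltW sy)).
  have : f y - f s <= U y - U s.
    apply: Hy => //=; rewrite ltr0_norm ?subr_lt0// opprB /y addrC addKr.
    by rewrite gt_min ltr_pdivrMr// ltr_pMr// ltr1n.
  by lra.
by move=> /(ub_le_sup (proj2 supS)); rewrite leNgt sy.
Unshelve. all: by end_near. Qed.

(** [g] is cut into the level sets [k e <= g < (k + 1) e]; each is covered by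
    an open set [W k] of nearly the same measure, and [u] is the sum of the
    [(k + 1) e] times the indicators of the [W k].  As [W k] is open, [u] stays
    above [g x] near every [x], so that its primitive can be compared locally
    with any function of derivative at most [g]. *)
Lemma vitali_caratheodory (g : R -> R) (a b e : R) : a < b -> 0 < e ->
  measurable_fun `]a, b[ g -> (forall x, x \in `]a, b[ -> 0 <= g x) ->
  exists u : R -> \bar R,
    [/\ measurable_fun [set: R] u, (forall x, 0 <= u x)%E,
        (\int[mu]_(x in `]a, b[) u x <=
           \int[mu]_(x in `]a, b[) (g x)%:E + (e * (b - a) + e)%:E)%E &
        forall x, x \in `]a, b[ ->
          exists2 c, g x < c & \forall y \near x, (c%:E <= u y)%E].
Proof.
move=> ab e0 mg g0.
set D := `]a, b[%classic.
have mD : measurable D by exact: measurable_itv.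
have muD : mu D = (b - a)%:E.
  by rewrite /D lebesgue_measure_itv/= lte_fin ab -EFinB.
pose E k := D `&` g @^-1` `[k%:R * e, k.+1%:R * e[.
have mE k : measurable (E k) by exact: mg.
have muE k : (mu (E k) < +oo)%E.
  apply: (@le_lt_trans _ _ (mu D)).
    apply: le_measure; rewrite ?inE; [exact: mE|exact: mD|by move=> x []].
  by rewrite muD ltry.
(* The weight (k + 1) e of W k turns this excess into e / 2 ^ (k + 1). *)
pose eps k : R := (k.+1%:R)^-1 / (2 ^ k.+1)%:R.
have eps0 k : 0 < eps k by rewrite divr_gt0// ?invr_gt0// ltr0n expn_gt0.
have /choice[V HV] k := lebesgue_regularity_outer (mE k) (muE k) (eps0 k).
pose W k := V k `&` D.
have oW k : open (W k).
  by apply: openI; [case: (HV k)|exact: interval_open].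
have mW k : measurable (W k) by exact: open_measurable.
have EW k : E k `<=` W k.
  by move=> x Ex; split; [case: (HV k) => _ + _; exact|case: Ex].
have muW k : (mu (W k) <= mu (E k) + (eps k)%:E)%E.
  rewrite -(setDUK (EW k)) (le_trans (measureU2 _ _ _))//.
  - exact: mE.
  - exact: measurableD (mW k) (mE k).
  rewrite leeD2l//; case: (HV k) => _ _ /ltW; apply: le_trans.
  have mV : measurable (V k) by apply: open_measurable; case: (HV k).
  apply: le_measure; rewrite ?inE.
  - exact: measurableD (mW k) (mE k).
  - exact: measurableD mV (mE k).
  - by apply: setSD; exact: subIsetl.
have w0 k : 0 <= k.+1%:R * e :> R by rewrite mulr_ge0// ltW.
pose u x := (\sum_(k <oo) ((k.+1%:R * e)%:E * (\1_(W k) x)%:E))%E.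
have t0 k x : (0 <= (k.+1%:R * e)%:E * (\1_(W k) x)%:E)%E.
  by rewrite mule_ge0// lee_fin.
have mt k : measurable_fun setT (fun x => (k.+1%:R * e)%:E * (\1_(W k) x)%:E)%E.
  apply/measurable_EFinP; apply: measurable_funM => //.
exists u; split.
- by apply: ge0_emeasurable_sum => // k x _ _.
- by move=> x; apply: nneseries_ge0 => k _ _.
- have mtD k : measurable_fun D (fun x => (k.+1%:R * e)%:E * (\1_(W k) x)%:E)%E.
    exact: measurable_funTS (mt k).
  rewrite /u (@integral_nneseries _ _ _ mu D mD _ mtD)//.
  apply: (@le_trans _ _ (\sum_(k <oo) ((\int[mu]_(x in E k) (g x + e)%:E) +
      (e / (2 ^ k.+1)%:R)%:E))%E).
    apply: lee_nneseries => k _.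
      by move=> _; apply: integral_ge0.
    rewrite ge0_integralZl_EFin//; last first.
      apply/measurable_EFinP; apply: measurable_funTS.
      apply: measurable_indic. exact: (mW k).
    rewrite integral_indic//; last exact: mW.
    have -> : W k `&` D = W k by rewrite /W -setIA setIid.
    apply: (@le_trans _ _ ((k.+1%:R * e)%:E * (mu (E k) + (eps k)%:E))%E).
      by apply: lee_wpmul2l; [rewrite lee_fin|exact: muW].
    rewrite ge0_muleDr// ?lee_fin ?(ltW (eps0 k))// leeD//.
      rewrite -integral_cst; last exact: mE.
      apply: ge0_le_integral => //.
      + exact: mE.
      + by move=> x _; rewrite lee_fin.
      + apply/measurable_EFinP; apply: measurable_funD => //.
        by apply: measurable_funS mg => //; exact: subIsetl.
      + move=> x [_ /=]; rewrite in_itv/= => /andP[h _].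
        by rewrite lee_fin -natr1 mulrDl mul1r lerD2r.
    rewrite -EFinM lee_fin /eps [leLHS](_ : _ = e / (2 ^ k.+1)%:R)//.
    have k0 : k.+1%:R != 0 :> R by [].
    by move: (k.+1%:R : R) k0 => x x0; rewrite mulrACA mulfV// mul1r.
  apply: (le_trans (epsilon_trick _ _ _)).
  + move=> n; apply: integral_ge0 => x [Dx _].
    by rewrite lee_fin addr_ge0// ?(ltW e0)// g0// inE.
  + exact: ltW.
  + rewrite EFinD addeA leeD2r//.
    have UE : \bigcup_k E k = D.
      apply/seteqP; split=> [x [k _ []]//|x Dx].
      have gx0 : 0 <= g x / e by rewrite divr_ge0 ?(ltW e0)// g0.
      exists (Num.truncn (g x / e)) => //; split=> //=.
      have /andP[h1 h2] := truncn_itv gx0.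
      by rewrite in_itv/= -ler_pdivlMr// h1 -ltr_pdivrMr.
    have mge : measurable_fun D (fun x => (g x + e)%:E).
      by apply/measurable_EFinP; apply: measurable_funD.
    rewrite -(@ge0_integral_bigcup _ _ _ mu E) ?UE//.
    + under eq_integral do rewrite EFinD.
      rewrite ge0_integralD//.
      * rewrite integral_cst// leeD2l//.
        rewrite [X in (_ * X)%E](_ : _ = (b - a)%:E) -?EFinM//; exact: muD.
      * exact/measurable_EFinP.
      * by move=> x Dx; rewrite lee_fin ltW.
    + by move=> x Dx; rewrite lee_fin addr_ge0// ?(ltW e0)// g0.
    + move=> i j _ _ [x [[_ /=]]]; rewrite in_itv/= => /andP[i1 i2].
      move=> [_]; rewrite /= in_itv/= => /andP[j1 j2].
      have := le_lt_trans i1 j2; rewrite ltr_pM2r// ltr_nat ltnS => ij.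
      have := le_lt_trans j1 i2; rewrite ltr_pM2r// ltr_nat ltnS => ji.
      by apply/eqP; rewrite eqn_leq ij.
- move=> x xD.
  have gx0 : 0 <= g x / e by rewrite divr_ge0 ?(ltW e0)// g0.
  pose k := Num.truncn (g x / e).
  have /andP[h1 h2] := truncn_itv gx0.
  exists (k.+1%:R * e); first by rewrite -ltr_pdivrMr.
  have : nbhs x (W k).
    apply: open_nbhs_nbhs; split; first exact: oW.
    by apply: EW; split=> //=; rewrite in_itv/= -ler_pdivlMr// h1 -ltr_pdivrMr.
  apply: filterS => y Wy.
  rewrite /u (@nneseriesD1 _ _ k)// indicE mem_set// mule1.
  by rewrite leeDl//; apply: nneseries_ge0.
Qed.

(** The primitive of the majorant grows at least as fast as [f] to the right of
    every point, so the local comparison applies. *)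
Lemma ge0_integral_growth (f g : R -> R) (a b : R) : a < b ->
  (forall x, a < x -> x <= b -> f y @[y --> x^'-] --> f x) ->
  f y @[y --> a^'+] --> f a ->
  (forall x, x \in `]a, b[ -> derivable f x 1) ->
  measurable_fun `]a, b[ g -> (forall x, x \in `]a, b[ -> 0 <= g x) ->
  (forall x, x \in `]a, b[ -> derive1 f x <= g x) ->
  ((f b - f a)%:E <= \int[mu]_(x in `]a, b[) (g x)%:E)%E.
Proof.
move=> ab fl fa df mg g0 fg.
have [->|foo] := eqVneq (\int[mu]_(x in `]a, b[) (g x)%:E)%E +oo%E.
  by rewrite leey.
apply/lee_addgt0Pr => e e0.
pose e' := e / (b - a + 1).
have ba0 : 0 < b - a + 1 by rewrite addr_gt0 ?subr_gt0.
have e'0 : 0 < e' by rewrite divr_gt0.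
have [u [mu_ u0 ui uloc]] := vitali_caratheodory ab e'0 mg g0.
have {}ui : (\int[mu]_(x in `]a, b[) u x <=
    \int[mu]_(x in `]a, b[) (g x)%:E + e%:E)%E.
  apply: (le_trans ui); rewrite leeD2l// lee_fin -[X in _ + X]mulr1 -mulrDr.
  by rewrite /e' divfK// gt_eqF.
apply: le_trans ui.
have mS (A : set R) : measurable_fun A u by exact: measurable_funTS mu_.
have mI (i : interval R) : measurable ([set` i] : set (measurableTypeR R)).
  exact: measurable_itv.
pose U x := (\int[mu]_(y in `]a, x[) u y)%E.
rewrite -/(U b).
have [->|Uoo] := eqVneq (U b) +oo%E; first by rewrite leey.
have U0 x : (0 <= U x)%E by apply: integral_ge0.
have ndU x y : x <= y -> (U x <= U y)%E.
  move=> xy; apply: ge0_subset_integral; [exact: mI|exact: mI|exact: mS| |].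
    by move=> ? _; exact: u0.
  by apply: subset_itvl; rewrite bnd_simp.
have Ufin x : x <= b -> U x \is a fin_num.
  move=> xb; rewrite ge0_fin_numE//; apply: (le_lt_trans (ndU _ _ xb)).
  by rewrite ltey.
have Ua : U a = 0%E by rewrite /U set_itvoo0 integral_set0.
rewrite -[U b]fineK ?Ufin// lee_fin.
have -> : fine (U b) = fine (U b) - fine (U a) by rewrite Ua subr0.
apply: (@increment_le_of_local f (fine \o U)) => //.
- move=> x y ax xy yb; rewrite /= fine_le//; last exact: ndU.
    by rewrite Ufin// (le_trans xy).
  by rewrite Ufin.
- move=> x xab.
  have xab' : x \in `]a, b[ by rewrite in_itv.
  have /andP[ax xb] := xab.
  have [c gc uc] := uloc _ xab'.
  have [G [fG cG Gx]] : exists G : R -> R, [/\ forall z : R, f z - f x = G z * (z - x),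
      {for x, continuous G} & G x = derive1 f x].
    apply/is_derive1_caratheodory; rewrite derive1E.
    exact/derivableP/df.
  have Gc : \forall y \near x, G y < c.
    by apply: (cvgr_lt _ cG); rewrite Gx (le_lt_trans (fg _ xab')).
  have [d /= d0 Hd] : \forall y \near x, G y < c /\ (c%:E <= u y)%E.
    by near=> y; split; near: y.
  near=> y.
  have xy : x < y by near: y; exact: nbhs_right_gt.
  have yb : y < b by near: y; exact: nbhs_right_lt.
  have yd : y < x + d by near: y; apply: nbhs_right_lt; rewrite ltrDl.
  have Hd' z : x <= z -> z <= y -> G z < c /\ (c%:E <= u z)%E.
    move=> xz zy; apply: Hd => /=.
    by rewrite distrC ger0_norm ?subr_ge0// ltrBlDl (le_lt_trans zy).
  rewrite fG; apply: (@le_trans _ _ (c * (y - x))).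
    by rewrite ler_wpM2r ?subr_ge0 ?ltW//; case: (Hd' y) => //; exact: ltW.
  have UD : U y = (U x + \int[mu]_(z in `[x, y[) u z)%E.
    rewrite {1}/U (@itv_bndbnd_setU _ _ (BRight a) (BLeft x) (BLeft y)); last first.
    - by rewrite bnd_simp ltW.
    - by rewrite bnd_simp.
    rewrite (@ge0_integral_setU _ _ _ mu _ _ (mI _) (mI _))//; first exact: mS.
    apply/disj_setPS => z [/=]; rewrite !in_itv/= => /andP[_ zx] /andP[+ _].
    by rewrite leNgt zx.
  have cU : ((c * (y - x))%:E <= \int[mu]_(z in `[x, y[) u z)%E.
    have -> : ((c * (y - x))%:E = \int[mu]_(z in `[x, y[) (cst c%:E z))%E.
      rewrite integral_cst; last exact: mI.
      by rewrite [X in (_ * X)%E]lebesgue_measure_itv/= lte_fin xy -EFinB.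
    have c0 : 0 <= c by rewrite (le_trans (g0 _ xab'))// ltW.
    apply: ge0_le_integral; [exact: mI| | |exact: mS|].
    - by move=> z _; rewrite lee_fin.
    - exact: measurable_cst.
    - by move=> z; rewrite /= in_itv/= => /andP[xz /ltW zy]; case: (Hd' z).
  have Iy : (\int[mu]_(z in `[x, y[) u z)%E \is a fin_num.
    rewrite ge0_fin_numE; last exact: integral_ge0.
    rewrite (@le_lt_trans _ _ (U y))//; last first.
      by rewrite -ge0_fin_numE// Ufin// ltW.
    by rewrite UD leeDr.
  rewrite /= UD fineD; [|by apply: Ufin; exact: ltW|exact: Iy].
  by rewrite addrAC subrr add0r -lee_fin fineK.
Unshelve. all: by end_near. Qed.

(** Replacing [f] by [f + n id] makes the nonnegative case apply to
    [max f' (- n)]; dominated convergence lets [n] go to infinity. *)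
Lemma integral_growth (f : R -> R) (a b : R) : a < b ->
  (forall x, a < x -> x <= b -> f y @[y --> x^'-] --> f x) ->
  f y @[y --> a^'+] --> f a ->
  (forall x, x \in `]a, b[ -> derivable f x 1) ->
  mu.-integrable `]a, b[ (EFin \o derive1 f) ->
  f b - f a <= \int[mu]_(x in `]a, b[) derive1 f x.
Proof.
move=> ab fl fa df intf.
set D := `]a, b[%classic.
have mD : measurable (D : set (measurableTypeR R)) by exact: measurable_itv.
have muD : mu D = (b - a)%:E.
  by rewrite /D lebesgue_measure_itv/= lte_fin ab -EFinB.
have mdf : measurable_fun D (derive1 f).
  by apply/measurable_EFinP; exact: (measurable_int mu).
pose h n x := Num.max (derive1 f x) (- n%:R).
have mh n : measurable_fun D (h n) by exact: measurable_maxr.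
have hdf n x : `|h n x| <= `|derive1 f x|.
  have n0 := ler0n R n; rewrite /h maxEle; case: ifPn => // dn.
  by rewrite normrN ger0_norm// ler0_norm; lra.
have inth n : mu.-integrable D (EFin \o h n).
  apply: (le_integrable mD _ _ intf); first by apply/measurable_EFinP; exact: mh.
  by move=> x _; rewrite lee_fin.
have step n : ((f b - f a)%:E <= \int[mu]_(x in D) (h n x)%:E)%E.
  pose fn x := f x + n%:R * x.
  have dfn x : x \in `]a, b[ -> is_derive x 1 fn (derive1 f x + n%:R).
    move=> xab; rewrite derive1E; have := derivableP (df x xab) => dfx.
    by rewrite /fn -[n%:R in X in is_derive _ _ _ X]mulr1; apply: is_deriveD.
  have intn : mu.-integrable D (EFin \o cst (n%:R : R)).
    by apply: (@itv_bounded_integrable _ _ _ n%:R) => // x _; rewrite /= ger0_norm.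
  have le1 : ((fn b - fn a)%:E <= \int[mu]_(x in D) (h n x + n%:R)%:E)%E.
    apply: ge0_integral_growth => //.
    - move=> x ax xb; apply: cvgD; first exact: fl.
      by apply: cvgM; [exact: cvg_cst|apply: cvg_at_left_filter; exact: cvg_id].
    - apply: cvgD => //.
      by apply: cvgM; [exact: cvg_cst|apply: cvg_at_right_filter; exact: cvg_id].
    - by move=> x xab; have := dfn x xab => ?; exact: ex_derive.
    - by apply: measurable_funD; [exact: mh|exact: measurable_cst].
    - by move=> x _; rewrite -lerBlDr sub0r le_max lexx orbT.
    - move=> x xab; have := dfn x xab => ?.
      by rewrite derive1E derive_val lerD2r le_max lexx.
  have hfin := integrable_fin_num mD (inth n).
  move: le1; rewrite (integralD_EFin mD (inth n) intn)/= integral_cst//.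
  rewrite [X in (_ * X)%E](_ : _ = (b - a)%:E); last exact: muD.
  rewrite -(fineK hfin) -EFinM -EFinD !lee_fin /fn; lra.
have dfin := integrable_fin_num mD intf.
rewrite -lee_fin /Rintegral fineK; last exact: dfin.
have [_ _ cvgh] : [/\ mu.-integrable D (EFin \o derive1 f),
  (\int[mu]_(x in D) `|(h n x)%:E - (derive1 f x)%:E|) @[n --> \oo] --> 0 &
  (\int[mu]_(x in D) (h n x)%:E) @[n --> \oo] --> \int[mu]_(x in D) (derive1 f x)%:E]%E.
  apply: (@dominated_convergence _ _ _ mu D mD _ _ (fun x => `|derive1 f x|%:E)).
  - by move=> n; apply/measurable_EFinP; exact: mh.
  - exact/measurable_EFinP.
  - apply: aeW => x _; apply: cvg_near_cst.
    near=> n; congr EFin; rewrite /h; apply/max_idPl.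
    rewrite -lerNl (le_trans (ler_norm _))// normrN ltW//.
    by near: n; exact: nbhs_infty_gtr.
  - by have := integrable_abse intf.
  - by apply: aeW => x n _; rewrite lee_fin.
rewrite -(cvg_lim _ cvgh)//; apply: lime_ge; first by apply/cvg_ex; eexists; exact: cvgh.
by near=> n; exact: step.
Unshelve. all: by end_near. Qed.

(** The Cantor function shows that continuity and differentiability almost
    everywhere would not suffice. *)
Lemma integral_derive1 (f : R -> R) (a b : R) : a < b ->
  (forall x, a < x -> x <= b -> f y @[y --> x^'-] --> f x) ->
  f y @[y --> a^'+] --> f a ->
  (forall x, x \in `]a, b[ -> derivable f x 1) ->
  mu.-integrable `]a, b[ (EFin \o derive1 f) ->
  f b - f a = \int[mu]_(x in `]a, b[) derive1 f x.
Proof.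
move=> ab fl fa df intf.
have mD : measurable (`]a, b[ : set (measurableTypeR R)) by exact: measurable_itv.
apply/eqP; rewrite eq_le integral_growth//=.
have dN x : x \in `]a, b[ -> - derive1 f x = derive1 (- f) x.
  by move=> xab; rewrite derive1N//; exact: df.
rewrite -[leRHS]opprK lerNr.
have -> : - (\int[mu]_(x in `]a, b[) derive1 f x) =
    \int[mu]_(x in `]a, b[) derive1 (- f) x.
  rewrite -mulN1r -RintegralZl//.
  by apply: eq_Rintegral => x; rewrite inE => xab; rewrite mulN1r dN.
rewrite opprB; have -> : f a - f b = (- f) b - (- f) a by rewrite opprK addrC.
apply: (@integral_growth (- f) a b ab).
- by move=> x ax xb; apply: cvgN; exact: fl.
- exact: cvgN.
- by move=> x xab; apply: derivableN; exact: df.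
- have intN := integrableZl mD (-1) intf.
  have NE : {in `]a, b[%classic, (fun x => (-1)%:E * (derive1 f x)%:E)%E
      =1 EFin \o derive1 (- f)}.
    by move=> x; rewrite inE => xab /=; rewrite -EFinM mulN1r dN.
  exact: (eq_integrable mD _ _ NE intN).
Qed.
End ftc.

(** * Euler's Gamma and Beta integrals *)
Section gamma.
Variable R : realType.
Notation mu := (@lebesgue_measure R).

Let affine_measurable (c d : R) :
  measurable_fun [set: measurableTypeR R] ((fun x => c * x + d) : _ -> measurableTypeR R).
Proof.
apply: measurable_funD; last exact: measurable_cst.
by apply: measurable_funM; [exact: measurable_cst|exact: measurable_id].
Qed.

Lemma ge0_integral_affine (c d : R) (f : R -> \bar R) : 0 < c ->
  measurable_fun [set: R] f -> (forall x, 0 <= f x)%E ->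
  (\int[mu]_x f x = c%:E * \int[mu]_x f (c * x + d)%R)%E.
Proof.
move=> c0 mf f0.
pose phi := (fun x => c * x + d) : measurableTypeR R -> measurableTypeR R.
have mphi : measurable_fun setT phi := affine_measurable c d.
have := ge0_integral_pushforward mphi mu measurableT mf (fun x _ => f0 x).
rewrite preimage_setT => <-.
pose c' := NngNum (ltW c0).
rewrite (_ : c%:E = c'%:num%:E)// -ge0_integral_mscale//.
apply: eq_measure_integral => A mA _; apply: lebesgue_measure_unique => //.
move=> _ [[x y] /= xy <-].
transitivity (c%:E * mu (phi @^-1` `]x, y]))%E; last by [].
have -> : phi @^-1` `]x, y] = `](x - d) / c, (y - d) / c]%classic.
  apply/seteqP; split => z /=; rewrite !in_itv/= /phi => /andP[h1 h2].
    by rewrite ltr_pdivrMr// ler_pdivlMr// mulrC ltrBlDr lerBrDr h1.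
  by move: h1 h2; rewrite ltr_pdivrMr// ler_pdivlMr// mulrC ltrBlDr lerBrDr => -> ->.
rewrite !lebesgue_measure_itv/= !lte_fin.
rewrite ltr_pM2r ?invr_gt0// ltrD2r; case: ifP => _; last by rewrite mule0.
rewrite -!EFinB -EFinM; congr EFin; rewrite -mulrBl mulrC divfK ?gt_eqF//; lra.
Qed.

(** Extending [u ^ (a - 1)] by 0 to the negative half-line turns the integrals
    over ]0, t[ of the theory into convolutions over the whole line, where
    translations and Fubini's theorem need no bookkeeping of domains. *)
Definition pow_kernel (a u : R) : R := if 0 < u then u `^ (a - 1) else 0.

Lemma pow_kernel_ge0 a u : 0 <= pow_kernel a u.
Proof. by rewrite /pow_kernel; case: ifP => // _; exact: powR_ge0. Qed.

Lemma pow_kernel_gt0E a u : 0 < u -> pow_kernel a u = u `^ (a - 1).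
Proof. by rewrite /pow_kernel => ->. Qed.

Lemma pow_kernel_le0E a u : u <= 0 -> pow_kernel a u = 0.
Proof. by rewrite /pow_kernel leNgt => /negbTE ->. Qed.

Lemma measurable_pow_kernel a : measurable_fun [set: R] (pow_kernel a).
Proof.
apply: measurable_fun_ifT => //.
exact: measurable_fun_ltr.
Qed.

Lemma pow_kernelM a c u : 0 < c -> pow_kernel a (c * u) = c `^ (a - 1) * pow_kernel a u.
Proof.
move=> c0; rewrite /pow_kernel pmulr_rgt0//; case: ifP => u0; last by rewrite mulr0.
by rewrite powRM// ltW.
Qed.

Lemma measurable_pow_kernel_affine a (c d : R) :
  measurable_fun [set: R] (fun s => pow_kernel a (c * s + d)).
Proof.
by apply: (measurableT_comp (measurable_pow_kernel a)); exact: affine_measurable.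
Qed.

Definition beta (a b : R) : \bar R :=
  (\int[mu]_s (pow_kernel a (1 - s) * pow_kernel b s)%:E)%E.

(** The substitution [s = (t - r) x + r] reduces to the interval ]0, 1[. *)
Lemma integral_pow_kernel_conv (a b t r : R) :
  (\int[mu]_s (pow_kernel a (t - s) * pow_kernel b (s - r))%:E)%E =
  ((pow_kernel (a + b) (t - r))%:E * beta a b)%E.
Proof.
have [rt|tr] := ltP r t; last first.
  rewrite pow_kernel_le0E ?subr_le0// mul0e integral0_eq// => s _.
  have [st|ts] := leP s r; first by rewrite (pow_kernel_le0E b) ?subr_le0// mulr0.
  by rewrite (pow_kernel_le0E a) ?mul0r// subr_le0 (le_trans tr)// ltW.
have c0 : 0 < t - r by rewrite subr_gt0.
have mf : measurable_fun [set: R] (fun s => (pow_kernel a (t - s) * pow_kernel b (s - r))%:E).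
  apply/measurable_EFinP; apply: measurable_funM.
    under eq_fun do rewrite -mulN1r addrC; exact: measurable_pow_kernel_affine.
  under eq_fun do rewrite -[X in X - _]mul1r; exact: measurable_pow_kernel_affine.
have f0 s : (0 <= (pow_kernel a (t - s) * pow_kernel b (s - r))%:E)%E.
  by rewrite lee_fin mulr_ge0// pow_kernel_ge0.
rewrite (ge0_integral_affine r c0 mf f0).
transitivity ((t - r)%:E * \int[mu]_s
   (((t - r) `^ (a - 1) * (t - r) `^ (b - 1))%:E * (pow_kernel a (1 - s) * pow_kernel b s)%:E))%E.
  congr (_ * _)%E; apply: eq_integral => s _.
  rewrite addrK (_ : t - _ = (t - r) * (1 - s)); last by ring.
  by rewrite !pow_kernelM// mulrACA EFinM.
rewrite ge0_integralZl_EFin//; last first.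
- by rewrite mulr_ge0// powR_ge0.
- apply/measurable_EFinP; apply: measurable_funM.
    under eq_fun do rewrite -mulN1r addrC; exact: measurable_pow_kernel_affine.
  exact: measurable_pow_kernel.
- by move=> s _; rewrite lee_fin mulr_ge0// pow_kernel_ge0.
rewrite muleA -EFinM; congr (_%:E * _)%E.
rewrite pow_kernel_gt0E// -powRD; last by rewrite (gt_eqF c0) implybT.
rewrite -{1}[t - r]powRr1 ?ltW// -powRD; last by rewrite (gt_eqF c0) implybT.
congr (_ `^ _); ring.
Qed.

(** The integral in the extended reals: identities between integrals of
    nonnegative functions hold before convergence is known. *)
Definition eGamma (a : R) : \bar R :=
  (\int[mu]_u (pow_kernel a u * expR (- u))%:E)%E.

Lemma Gamma_eGamma a : Gamma a = fine (eGamma a).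
Proof.
rewrite /Gamma /Rintegral /eGamma integral_mkcond; congr fine.
apply: eq_integral => u _; rewrite patchE.
have [u0|u0] := ltP 0 u.
  by rewrite mem_set ?pow_kernel_gt0E//= in_itv/= u0.
rewrite memNset ?pow_kernel_le0E ?mul0r//= in_itv/= andbT => u0'.
by move: u0; rewrite leNgt u0'.
Qed.

Lemma measurable_eGamma a : measurable_fun [set: R] (fun u => pow_kernel a u * expR (- u)).
Proof.
apply: measurable_funM; first exact: measurable_pow_kernel.
by apply: measurableT_comp.
Qed.

Lemma eGamma_ge0 a : (0 <= eGamma a)%E.
Proof.
by apply: integral_ge0 => u _; rewrite lee_fin mulr_ge0 ?pow_kernel_ge0 ?expR_ge0.
Qed.

(** Euler's identity: the product of the two Gamma integrals, written in the
    variables [u] and [w = u + v], is the integral over [w] of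
    [expR (- w)] times a convolution of powers. *)
Lemma eGamma_beta (a b : R) :
  (eGamma b * eGamma a = beta a b * eGamma (a + b))%E.
Proof.
pose g (a u : R) := pow_kernel a u * expR (- u).
have g0 c u : (0 <= (g c u)%:E)%E.
  by rewrite lee_fin mulr_ge0 ?pow_kernel_ge0 ?expR_ge0.
have mg c : measurable_fun [set: R] (EFin \o g c).
  by apply/measurable_EFinP; exact: measurable_eGamma.
pose F (z : R * R) := (g b z.1 * g a (z.2 - z.1))%:E.
transitivity (\int[mu]_u \int[mu]_w F (u, w))%E.
  rewrite /eGamma -ge0_integralZr//; [|exact: mg|by move=> u _; exact: g0|exact: eGamma_ge0].
  apply: eq_integral => u _.
  rewrite (ge0_integral_affine (- u) ltr01 (mg a) (g0 a)).
  have mga : measurable_fun [set: R] (fun w => (g a (1 * w - u))%:E).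
    exact: (measurableT_comp (mg a) (affine_measurable 1 (- u))).
  have gb0 : 0 <= g b u := g0 b u.
  rewrite mul1e -(ge0_integralZl_EFin mu measurableT (fun x _ => g0 a _) mga gb0).
  by apply: eq_integral => w _ /=; rewrite mul1r -EFinM.
have mF : measurable_fun [set: measurableTypeR R * measurableTypeR R] F.
  apply/measurable_EFinP; apply: measurable_funM.
    apply: measurableT_comp (measurable_eGamma b) _; exact: measurable_fst.
  apply: measurableT_comp (measurable_eGamma a) _.
  by apply: measurable_funB; [exact: measurable_snd|exact: measurable_fst].
have F0 z : (0 <= F z)%E by rewrite /F EFinM mule_ge0.
transitivity (\int[mu]_w \int[mu]_u F (u, w))%E.
  exact: (@fubini_tonelli _ _ _ _ _ mu mu F mF F0).
transitivity (\int[mu]_w ((expR (- w) * pow_kernel (a + b) w)%:E * beta a b))%E.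
  apply: eq_integral => w _.
  transitivity (\int[mu]_u ((expR (- w))%:E * (pow_kernel a (w - u) * pow_kernel b (u - 0))%:E))%E.
    apply: eq_integral => u _; rewrite /F /g/= -EFinM subr0; congr EFin.
    have -> : - w = - u + - (w - u) by ring.
    by rewrite expRD; ring.
  have mc : measurable_fun [set: R] (fun u => (pow_kernel a (w - u) * pow_kernel b (u - 0))%:E).
    apply/measurable_EFinP; apply: measurable_funM.
      under eq_fun do rewrite -mulN1r addrC; exact: measurable_pow_kernel_affine.
    under eq_fun do rewrite -[X in X - _]mul1r; exact: measurable_pow_kernel_affine.
  have c0 u : (0 <= (pow_kernel a (w - u) * pow_kernel b (u - 0))%:E)%E.
    by rewrite lee_fin mulr_ge0// pow_kernel_ge0.
  rewrite (ge0_integralZl_EFin mu measurableT (fun u _ => c0 u) mc (expR_ge0 _)).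
  by rewrite integral_pow_kernel_conv subr0 muleA -EFinM.
have mG : measurable_fun [set: R] (fun w => (expR (- w) * pow_kernel (a + b) w)%:E).
  under eq_fun do rewrite mulrC; exact: mg.
have G0 w : (0 <= (expR (- w) * pow_kernel (a + b) w)%:E)%E.
  by rewrite lee_fin mulr_ge0 ?pow_kernel_ge0 ?expR_ge0.
have beta0 : (0 <= beta a b)%E.
  by apply: integral_ge0 => u _; rewrite lee_fin mulr_ge0// pow_kernel_ge0.
rewrite (ge0_integralZr mu measurableT mG (fun w _ => G0 w) beta0) muleC.
by congr (_ * _)%E; apply: eq_integral => w _; rewrite mulrC.
Qed.

Lemma integral_powR01 (a : R) : 0 < a ->
  (\int[mu]_(u in `]0%R, 1%R]) (u `^ (a - 1))%:E <= a^-1%:E)%E.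
Proof.
move=> a0.
pose F n : set (measurableTypeR R) := `[n.+1%:R^-1, 1]%classic.
have n0 n : 0 < n.+1%:R^-1 :> R by rewrite invr_gt0.
have n1 n : n.+1%:R^-1 <= 1 :> R by rewrite invf_le1// ler1n.
have UF : \bigcup_n F n = `]0, 1]%classic.
  apply/seteqP; split=> [x [n _]|x]; rewrite /F/= !in_itv/= => /andP[x0 x1].
    by rewrite x1 andbT (lt_le_trans _ x0).
  have [n _ /(_ n (leqnn n)) nx] := near_infty_natSinv_lt (PosNum x0).
  by exists n => //=; rewrite in_itv/= x1 andbT ltW.
have mF n : measurable (F n) by exact: measurable_itv.
have mp (A : set (measurableTypeR R)) : measurable_fun A (fun u => (u `^ (a - 1))%:E).
  by apply/measurable_EFinP; apply: measurable_funTS; exact: measurable_powR.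
have ndF : nondecreasing_seq F.
  move=> m n mn; apply/subsetPset => x; rewrite /F/= !in_itv/= => /andP[mx x1].
  by rewrite x1 andbT (le_trans _ mx)// lef_pV2 ?posrE// ler_nat ltnS.
have cv := @ge0_nondecreasing_set_cvg_integral _ _ _ F
  (fun u => (u `^ (a - 1))%:E) mu ndF mF (fun n => mp (F n))
  (fun n x _ => powR_ge0 x (a - 1)).
rewrite UF in cv; rewrite -(cvg_lim _ cv)//.
apply: lime_le; first exact: (cvgP _ cv).
near=> n.
have lt1 : n.+1%:R^-1 < 1 :> R.
  by rewrite invf_lt1// ltr1n ltnS; near: n; exact: nbhs_infty_gt.
have dp x : 0 < x -> derivable (fun u => u `^ a) x 1.
  by move=> x0; apply: derivable_powR; rewrite in_itv/= x0.
have cp c (x : R) : 0 < x -> {for x, continuous (fun u => u `^ c)}.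
  move=> x0; apply/differentiable_continuous/derivable1_diffP.
  by apply: derivable_powR; rewrite in_itv/= x0.
have cF (x : R) : 0 < x -> {for x, continuous (fun u => a^-1 * u `^ a)}.
  by move=> x0; apply: cvgM; [exact: cvg_cst|exact: cp].
rewrite /F (@continuous_FTC2 _ _ (fun u => a^-1 * u `^ a))//.
- rewrite -EFinB lee_fin powR1 mulr1 gerBl mulr_ge0 ?powR_ge0//.
  by rewrite invr_ge0 ltW.
- apply: continuous_in_subspaceT => x; rewrite inE/= in_itv/= => /andP[nx _].
  by apply: cp; exact: lt_le_trans nx.
- split.
  + move=> x; rewrite in_itv/= => /andP[nx _].
    by apply: derivableM => //; apply: dp; exact: lt_trans nx.
  + by apply: cvg_at_right_filter; exact: cF.
  + by apply: cvg_at_left_filter; exact: cF.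
- move=> x; rewrite in_itv/= => /andP[nx _]; have x0 : 0 < x by exact: lt_trans nx.
  rewrite derive1Ml; last exact: dp.
  rewrite powR_derive1 ?in_itv/= ?x0// mulrA mulVf ?mul1r// gt_eqF//.
Unshelve. all: by end_near. Qed.

(** Near 0 the integrand is at most [u ^ (a - 1)]; beyond 1 the logarithm being
    sublinear bounds the power by a multiple of [expR (u / 2)]. *)
Lemma eGamma_lty (a : R) : 0 < a -> (eGamma a < +oo)%E.
Proof.
move=> a0.
pose c := `|a - 1| + 1.
have c1 : 1 <= c by rewrite lerDr.
have c0 : 0 < c by exact: lt_le_trans c1.
pose K := 2 * expR (c * ln (2 * c)).
have K0 : 0 <= K by rewrite mulr_ge0// expR_ge0.
pose h1 := (fun u : R => u `^ (a - 1)) \_ `]0, 1]%classic.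
pose h2 u := K * exponential_pdf (2^-1 : R) u.
have h0 : (0 : R) <= 2^-1 by [].
have h20 u : 0 <= h2 u by rewrite mulr_ge0// exponential_pdf_ge0.
have h10 u : 0 <= h1 u by rewrite /h1 patchE; case: ifP => // _; exact: powR_ge0.
have bound u : pow_kernel a u * expR (- u) <= h1 u + h2 u.
  have [u0|u0] := ltP 0 u; last by rewrite pow_kernel_le0E// mul0r addr_ge0.
  have [u1|u1] := leP u 1.
    apply: (@le_trans _ _ (h1 u)); last by rewrite lerDl.
    rewrite /h1 patchE mem_set/= ?in_itv/= ?u0// pow_kernel_gt0E//.
    by rewrite ler_piMr ?powR_ge0// -expR0 ler_expR oppr_le0 ltW.
  apply: (@le_trans _ _ (h2 u)); last by rewrite lerDr.
  rewrite /h2 exponential_pdfE// /K ?(ltW u0)// mulrACA mulfV// mul1r.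
  rewrite pow_kernel_gt0E// /powR gt_eqF// -!expRD ler_expR.
  have lnu : ln u <= ln (2 * c) + u / (2 * c).
    have cc : 0 < 2 * c by rewrite mulr_gt0.
    have := ln_sublinear (divr_gt0 u0 cc).
    by rewrite ln_div ?posrE// => /ltW; rewrite lerBlDr addrC.
  have lnu0 : 0 <= ln u by rewrite ln_ge0// ltW.
  have le1 : (a - 1) * ln u <= c * ln u.
    by rewrite ler_wpM2r// /c (le_trans (ler_norm _))// lerDl.
  have le2 : c * ln u <= c * (ln (2 * c) + u / (2 * c)) by rewrite ler_wpM2l// ltW.
  have e3 : c * (u / (2 * c)) = u / 2.
    by field; rewrite gt_eqF.
  lra.
have mh1 : measurable_fun [set: R] h1.
  apply/measurable_restrict => //; exact: measurable_funTS (measurable_powR _).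
have mh2 : measurable_fun [set: R] h2.
  by apply: measurable_funM => //; exact: measurable_exponential_pdf.
apply: (@le_lt_trans _ _ (\int[mu]_u ((h1 u)%:E + (h2 u)%:E))%E).
  apply: ge0_le_integral => //.
  - by move=> u _; rewrite lee_fin mulr_ge0 ?pow_kernel_ge0 ?expR_ge0.
  - by apply/measurable_EFinP; exact: measurable_eGamma.
  - by apply: emeasurable_funD; apply/measurable_EFinP; [exact: mh1|exact: mh2].
  - by move=> u _; rewrite -EFinD lee_fin.
have l0 u : (0 <= (h1 u)%:E)%E by rewrite lee_fin.
have l1 u : (0 <= (h2 u)%:E)%E by rewrite lee_fin.
rewrite (ge0_integralD mu measurableT (fun u _ => l0 u) _ (fun u _ => l1 u)); first last.
- by apply/measurable_EFinP; exact: mh2.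
- by apply/measurable_EFinP; exact: mh1.
apply: lte_add_pinfty.
  apply: (@le_lt_trans _ _ (a^-1)%:E); last by rewrite ltry.
  apply: le_trans (integral_powR01 a0); rewrite [leRHS]integral_mkcond.
  rewrite le_eqVlt; apply/orP; left; apply/eqP; apply: eq_integral => u _.
  by rewrite /h1 !patchE; case: ifP.
under eq_integral do rewrite EFinM.
rewrite ge0_integralZl_EFin//.
- by rewrite integral_exponential_pdf ?invr_gt0// mule1 ltry.
- by move=> u _; rewrite lee_fin exponential_pdf_ge0.
- by apply/measurable_EFinP; exact: measurable_exponential_pdf.
Qed.
Lemma eGamma_lower_bound (a M c : R) : 0 <= c ->
  (forall u, M <= u <= M + 1 -> c <= pow_kernel a u * expR (- u)) ->
  (c%:E <= eGamma a)%E.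
Proof.
move=> c0 cle.
have mI : measurable (`[M, M + 1] : set (measurableTypeR R)) by exact: measurable_itv.
have mg : measurable_fun [set: R] (fun u => (pow_kernel a u * expR (- u))%:E).
  by apply/measurable_EFinP; exact: measurable_eGamma.
have g0 u : (0 <= (pow_kernel a u * expR (- u))%:E)%E.
  by rewrite lee_fin mulr_ge0 ?pow_kernel_ge0 ?expR_ge0.
apply: (@le_trans _ _ (\int[mu]_(u in `[M, (M + 1)%R]) (pow_kernel a u * expR (- u))%:E)%E).
  have -> : c%:E = (\int[mu]_(u in `[M, (M + 1)%R]) (cst c%:E u))%E.
    rewrite integral_cst; last exact: mI.
    rewrite [X in (_ * X)%E]lebesgue_measure_itv/= lte_fin ltrDl ltr01 -EFinB.
    by rewrite addrC addKr mule1.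
  apply: ge0_le_integral; [exact: mI| | | |].
  - by move=> u _; rewrite lee_fin.
  - exact: measurable_cst.
  - exact: measurable_funTS mg.
  - by move=> u; rewrite /= in_itv/= => /cle; rewrite lee_fin.
by apply: ge0_subset_integral; [exact: mI|by []|exact: mg|by move=> ? _; exact: g0|].
Qed.

Lemma eGamma_fin a : 0 < a -> eGamma a \is a fin_num.
Proof. by move=> a0; rewrite ge0_fin_numE ?eGamma_lty// eGamma_ge0. Qed.

Lemma GammaE (a : R) : 0 < a -> (Gamma a)%:E = eGamma a.
Proof. by move=> a0; rewrite Gamma_eGamma fineK// eGamma_fin. Qed.

(** On [1, 2] one has [0 <= ln u <= 1], which bounds the power from below for
    every exponent. *)
Lemma Gamma_gt0 (a : R) : 0 < a -> 0 < Gamma a.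
Proof.
move=> a0; rewrite -lte_fin GammaE//.
pose c := expR (- `|a - 1|) * expR (- 2).
apply: (@lt_le_trans _ _ c%:E); first by rewrite lte_fin mulr_gt0 ?expR_gt0.
apply: (@eGamma_lower_bound _ 1); first by rewrite mulr_ge0 ?expR_ge0.
move=> u /andP[u1 u2]; have u0 : 0 < u by exact: lt_le_trans u1.
rewrite pow_kernel_gt0E// ler_pM ?expR_ge0//; last by rewrite ler_expR; lra.
rewrite /powR gt_eqF// ler_expR.
have l0 : 0 <= ln u by rewrite ln_ge0.
have l1 : ln u <= 1.
  have -> : u = 1 + (u - 1) by lra.
  by apply: (le_trans (le_ln1Dx _)); lra.
rewrite lerNl -mulNr (le_trans (ler_norm _))// normrM normrN.
by rewrite ler_piMr// ger0_norm.
Qed.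

(** With [M] arbitrary, this is the superexponential growth of Gamma. *)
Lemma Gamma_ge (a M : R) : 1 <= a -> 0 < M ->
  M `^ (a - 1) * expR (- (M + 1)) <= Gamma a.
Proof.
move=> a1 M1; have a0 : 0 < a by exact: lt_le_trans a1.
rewrite -lee_fin GammaE//.
apply: (@eGamma_lower_bound _ M); first by rewrite mulr_ge0 ?powR_ge0 ?expR_ge0.
move=> u /andP[Mu u2]; have u0 : 0 < u by exact: lt_le_trans Mu.
rewrite pow_kernel_gt0E// ler_pM ?expR_ge0 ?powR_ge0//; last by rewrite ler_expR; lra.
by rewrite ge0_ler_powR// ?nnegrE ?subr_ge0// ltW.
Qed.

Lemma Gamma1 : Gamma (1 : R) = 1.
Proof.
apply: EFin_inj; rewrite GammaE// -(@integral_exponential_pdf R 1)//.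
transitivity (\int[mu]_(u in `]0%R, +oo[) (expR (- u))%:E)%E.
  rewrite [RHS]integral_mkcond; apply: eq_integral => u _; rewrite patchE.
  have [u0|u0] := ltP 0 u.
    by rewrite mem_set/= ?in_itv/= ?u0// pow_kernel_gt0E// subrr powRr0 mul1r.
  by rewrite memNset/= ?in_itv/= ?ltNge ?u0// pow_kernel_le0E// mul0r.
rewrite integral_itv_obnd_cbnd; last first.
  apply/measurable_EFinP; apply: measurable_funTS.
  by apply: measurableT_comp.
rewrite integral_mkcond; apply: eq_integral => u _.
rewrite /exponential_pdf !patchE; case: ifP => // _.
by rewrite mul1r mulN1r.
Qed.

Lemma betaE (a b : R) : 0 < a -> 0 < b ->
  beta a b = (Gamma a * Gamma b / Gamma (a + b))%:E.
Proof.
move=> a0 b0; have ab0 : 0 < a + b by rewrite addr_gt0.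
have G0 := Gamma_gt0 ab0.
have := eGamma_beta a b; rewrite -!GammaE// -EFinM => h.
have : (beta a b * (Gamma (a + b))%:E * ((Gamma (a + b))^-1)%:E)%E =
   (Gamma b * Gamma a / Gamma (a + b))%:E by rewrite -h.
by rewrite -muleA -EFinM (mulfV (lt0r_neq0 G0)) mule1 (mulrC (Gamma b)).
Qed.

Lemma integral_conv_powR (a b t : R) : 0 < a -> 0 <= b -> 0 < t ->
  (\int[mu]_(s in `]0%R, t[) ((t - s) `^ (a - 1) * s `^ b)%:E =
   (Gamma a * Gamma (b + 1) / Gamma (a + b + 1) * t `^ (a + b))%:E)%E.
Proof.
move=> a0 b0 t0.
rewrite integral_mkcond.
transitivity (\int[mu]_s (pow_kernel a (t - s) * pow_kernel (b + 1) (s - 0))%:E)%E.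
  apply: eq_integral => s _; rewrite patchE subr0.
  have [s0|s0] := ltP 0 s; last first.
    rewrite memNset/=; first by rewrite (pow_kernel_le0E (b + 1))// mulr0.
    by rewrite in_itv/= ltNge s0.
  have [st|ts] := ltP s t.
    by rewrite mem_set/= ?in_itv/= ?s0// !pow_kernel_gt0E ?subr_gt0// addrK.
  rewrite memNset/=; first by rewrite (pow_kernel_le0E a) ?subr_le0// mul0r.
  by rewrite in_itv/= [s < t]ltNge ts andbF.
rewrite integral_pow_kernel_conv betaE//; last by rewrite ltr_wpDl.
rewrite -EFinM subr0 pow_kernel_gt0E// addrA addrK mulrC.
by [].
Qed.

Lemma integrable_conv_powR (a t : R) : 0 < a -> 0 < t ->
  mu.-integrable `]0, t[ (EFin \o (fun s => (t - s) `^ (a - 1))).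
Proof.
move=> a0 t0; apply/integrableP; split.
  apply/measurable_EFinP; apply: measurable_funTS.
  apply: (measurableT_comp (measurable_powR _)).
  by apply: measurable_funB; [exact: measurable_cst|exact: measurable_id].
have := @integral_conv_powR a 0 t a0 (lexx _) t0.
under eq_integral do rewrite powRr0 mulr1.
move=> h; under eq_integral do rewrite /= ger0_norm ?powR_ge0//.
by rewrite h ltry.
Qed.
End gamma.

(** * Fractional integrals and triangular Volterra systems *)
Section riemann_liouville.
Variable R : realType.
Notation mu := (@lebesgue_measure R).

Let mitv (a b : R) : measurable (`]a, b[ : set (measurableTypeR R)).
Proof. exact: measurable_itv. Qed.

(** The kernel is bounded below by [t ^ (- a)] on ]0, t[. *)
Lemma integrable_of_abel_kernel (a t : R) (g : R -> R) : 0 < a -> 0 < t ->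
  mu.-integrable `]0, t[ (EFin \o (fun r => (t - r) `^ (- a) * g r)) ->
  mu.-integrable `]0, t[ (EFin \o g).
Proof.
move=> a0 t0 ig.
have mk : measurable_fun (`]0, t[ : set R) (fun r => (t - r) `^ a).
  apply: measurable_funTS; apply: (measurableT_comp (measurable_powR _)).
  by apply: measurable_funB; [exact: measurable_cst|exact: measurable_id].
have gE r : r \in `]0, t[ -> g r = (t - r) `^ a * ((t - r) `^ (- a) * g r).
  rewrite in_itv/= => /andP[r0 rt].
  have tr : 0 < t - r by rewrite subr_gt0.
  by rewrite mulrA -powRD ?(gt_eqF tr) ?implybT// subrr powRr0 mul1r.
have mg : measurable_fun (`]0, t[ : set R) g.
  have mkg : measurable_fun (`]0, t[ : set R)
      (fun r => (t - r) `^ a * ((t - r) `^ (- a) * g r)).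
    apply: measurable_funM => //.
    by apply/measurable_EFinP; exact: (measurable_int mu).
  by apply: eq_measurable_fun mkg => r; rewrite inE => /gE <-.
apply: (le_integrable (mitv 0 t) _ _ (integrableZl (mitv 0 t) (t `^ a) ig)).
  by apply/measurable_EFinP; exact: mg.
move=> r /= rt; rewrite lee_fin {1}(gE r rt).
rewrite [leRHS]normrM normrM ler_wpM2r// !ger0_norm ?powR_ge0//.
move: rt; rewrite in_itv/= => /andP[r0 rt].
by rewrite ge0_ler_powR// ?nnegrE ?subr_ge0 ?(ltW a0) ?(ltW rt) ?(ltW t0)// gerBl ltW.
Qed.

(** Exchanging the integrals leaves, for each [r], the integral over [s] of
    [(t - s) ^ (a - 1) (s - r) ^ (- a)], which is the Beta integral
    B(a, 1 - a) = Gamma a * Gamma (1 - a) and does not depend on [r]. *)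
Lemma abel_inversion (a t : R) (g : R -> R) : 0 < a < 1 -> 0 < t ->
  (forall s, 0 < s -> mu.-integrable `]0, s[
     (EFin \o (fun r => (s - r) `^ (- a) * g r))) ->
  \int[mu]_(s in `]0, t[) ((t - s) `^ (a - 1) *
     \int[mu]_(r in `]0, s[) ((s - r) `^ (- a) * g r)) =
  Gamma a * Gamma (1 - a) * \int[mu]_(r in `]0, t[) g r.
Proof.
move=> /andP[a0 a1] t0 ig.
have a1' : 0 < 1 - a by rewrite subr_gt0.
have igt := integrable_of_abel_kernel a0 t0 (ig t t0).
pose psi := g \_ `]0, t[%classic.
have psiE r : r \in `]0, t[ -> psi r = g r.
  by move=> rt; rewrite /psi patchE mem_set.
have psi0 r : r \notin `]0, t[ -> psi r = 0.
  by move=> rt; rewrite /psi patchE memNset//; exact/negP.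
have mpsi : measurable_fun [set: R] psi.
  apply/(measurable_restrictT _ _).1 => //.
  by apply/measurable_EFinP; exact: (measurable_int mu).
pose k (s r : R) := pow_kernel a (t - s) * pow_kernel (1 - a) (s - r).
have k0 s r : 0 <= k s r by rewrite mulr_ge0// pow_kernel_ge0.
pose B := Gamma a * Gamma (1 - a).
have intk r : r \in `]0, t[ -> (\int[mu]_s (k s r)%:E = B%:E)%E.
  rewrite in_itv/= => /andP[r0 rt].
  rewrite integral_pow_kernel_conv betaE// (addrC a) subrK Gamma1 divr1.
  by rewrite pow_kernel_gt0E ?subr_gt0// subrr powRr0 mul1e.
have ipsi : mu.-integrable setT (EFin \o psi).
  have -> : EFin \o psi = (EFin \o g) \_ `]0, t[%classic.
    by apply/funext => r; rewrite /= /psi !patchE; case: ifP.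
  exact/(integrable_mkcond _ (mitv 0 t)).
have mks : measurable_fun [set: R] (fun s => pow_kernel a (t - s)).
  apply: (measurableT_comp (measurable_pow_kernel a)).
  by apply: measurable_funB; [exact: measurable_cst|exact: measurable_id].
have mkr r : measurable_fun [set: R] (fun s => pow_kernel (1 - a) (s - r)).
  apply: (measurableT_comp (measurable_pow_kernel _)).
  by apply: measurable_funB; [exact: measurable_id|exact: measurable_cst].
have mk r : measurable_fun [set: R] (fun s => (k s r)%:E).
  by apply/measurable_EFinP; apply: measurable_funM; [exact: mks|exact: mkr].
have ik r : r \in `]0, t[ -> mu.-integrable setT (fun s => (k s r)%:E).
  move=> rt; apply/integrableP; split; first exact: mk.
  under eq_integral do rewrite /= ger0_norm ?k0//.
  by rewrite intk// ltry.
pose K (z : measurableTypeR R * measurableTypeR R) := (k z.1 z.2 * psi z.2)%:E.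
have mK : measurable_fun setT K.
  apply/measurable_EFinP; apply: measurable_funM; last first.
    by apply: measurableT_comp mpsi _; exact: measurable_snd.
  apply: measurable_funM.
    by apply: measurableT_comp mks _; exact: measurable_fst.
  apply: measurableT_comp (measurable_pow_kernel (1 - a)) _.
  by apply: measurable_funB; [exact: measurable_fst|exact: measurable_snd].
have B0 : 0 <= B by rewrite mulr_ge0// ltW// Gamma_gt0.
have mT : measurable (setT : set (measurableTypeR R)) by exact: measurableT.
have iK : ((mu \x mu)%E).-integrable setT K.
  apply/(integrable21ltyP mu mu mK).
  apply: (@le_lt_trans _ _ (\int[mu]_r (B%:E * `|(psi r)%:E|))%E).
    rewrite le_eqVlt; apply/orP; left; apply/eqP; apply: eq_integral => r _.
    have [rt|rt] := boolP (r \in `]0, t[); last first.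
      rewrite psi0// abse0 mule0; apply: integral0_eq => s _.
      by rewrite /K/= psi0// mulr0 normr0.
    transitivity (\int[mu]_s ((k s r)%:E * `|(psi r)%:E|))%E.
      by apply: eq_integral => s _; rewrite /K/= normrM ger0_norm// EFinM.
    have p0 : (0 <= `|(psi r)%:E|)%E by exact: abse_ge0.
    by rewrite (ge0_integralZr mu mT (mk r) (fun s _ => k0 s r) p0) intk.
  have mp : measurable_fun [set: R] (fun r => `|(psi r)%:E|)%E.
    by apply: measurableT_comp => //; apply/measurable_EFinP; exact: mpsi.
  rewrite (ge0_integralZl_EFin mu mT (fun r _ => abse_ge0 (psi r)%:E) mp B0).
  rewrite lte_mul_pinfty ?lee_fin//.
  by have /integrableP[] := ipsi.
have KF := Fubini iK.
have LHS : (\int[mu]_s \int[mu]_r K (s, r) = \int[mu]_(s in `]0%R, t[)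
  ((t - s) `^ (a - 1) * \int[mu]_(r in `]0, s[) ((s - r) `^ (- a) * g r))%:E)%E.
  rewrite [RHS]integral_mkcond; apply: eq_integral => s _; rewrite patchE.
  have [st|st] := boolP (s \in `]0, t[); last first.
    rewrite memNset; last exact/negP.
    apply: integral0_eq => r _; rewrite /K/=.
    have [rt|rt] := boolP (r \in `]0, t[); last by rewrite psi0// mulr0.
    move: rt st; rewrite !in_itv/= => /andP[r0 rt].
    rewrite negb_and -!leNgt /k => /orP[s0|ts].
      by rewrite (pow_kernel_le0E (1 - a)) ?mulr0 ?mul0r// subr_le0 (le_trans s0)// ltW.
    by rewrite (pow_kernel_le0E a) ?mul0r// subr_le0.
  rewrite mem_set//; move: st; rewrite in_itv/= => /andP[s0 st].
  pose h := (EFin \o (fun r => (s - r) `^ (- a) * g r)) \_ `]0, s[%classic.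
  have ih : mu.-integrable setT h.
    by apply/(integrable_mkcond _ (mitv 0 s)); exact: ig.
  transitivity (\int[mu]_r (((t - s) `^ (a - 1))%:E * h r))%E.
    apply: eq_integral => r _; rewrite /K /k/= pow_kernel_gt0E ?subr_gt0//.
    rewrite -mulrA EFinM; congr (_ * _)%E; rewrite /h patchE.
    have [rs|rs] := boolP (r \in `]0, s[).
      rewrite mem_set//=; move: rs; rewrite in_itv/= => /andP[r0 rs].
      rewrite pow_kernel_gt0E ?subr_gt0// psiE; first by rewrite addrAC subrr add0r.
      by rewrite in_itv/= r0 (lt_trans rs).
    rewrite memNset; last exact/negP.
    move: rs; rewrite in_itv/= negb_and -!leNgt => /orP[r0|sr].
      by rewrite psi0 ?mulr0// in_itv/= [0 < r]ltNge r0.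
    by rewrite pow_kernel_le0E ?mul0r// subr_le0.
  rewrite (integralZl mT ih) EFinM; congr (_ * _)%E.
  have fs := integrable_fin_num (mitv 0 s) (ig s s0).
  by rewrite /h -integral_mkcond /Rintegral fineK//; exact: fs.
have RHS : (\int[mu]_r \int[mu]_s K (s, r) = B%:E * \int[mu]_(r in `]0%R, t[) (g r)%:E)%E.
  transitivity (\int[mu]_r (B%:E * (psi r)%:E))%E.
    apply: eq_integral => r _.
    have [rt|rt] := boolP (r \in `]0, t[); last first.
      rewrite psi0// mule0; apply: integral0_eq => s _.
      by rewrite /K/= psi0// mulr0.
    transitivity (\int[mu]_s ((k s r)%:E * (psi r)%:E))%E.
      by apply: eq_integral => s _; rewrite /K/= EFinM.
    by rewrite (integralZr mT (ik r rt)) intk.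
  rewrite (integralZl mT ipsi); congr (_ * _)%E.
  rewrite [RHS]integral_mkcond; apply: eq_integral => r _.
  by rewrite /psi/= !patchE; case: ifP.
have ft := integrable_fin_num (mitv 0 t) igt.
by rewrite /Rintegral -LHS KF RHS fineM//; exact: ft.
Qed.

Definition bounded_mfun (t : R) (h : R -> R) : Prop :=
  measurable_fun (`]0, t[ : set R) h /\
  exists M, forall s, s \in `]0, t[ -> `|h s| <= M.

Lemma bounded_mfunD t g h : bounded_mfun t g -> bounded_mfun t h ->
  bounded_mfun t (fun s => g s + h s).
Proof.
move=> [mg [M gM]] [mh [N hN]]; split; first exact: measurable_funD.
by exists (M + N) => s st; rewrite (le_trans (ler_normD _ _))// lerD ?gM ?hN.
Qed.

Lemma bounded_mfunZ t c h : bounded_mfun t h -> bounded_mfun t (fun s => c * h s).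
Proof.
move=> [mh [N hN]]; split.
  by apply: measurable_funM; [exact: measurable_cst|exact: mh].
by exists (`|c| * N) => s st; rewrite normrM ler_wpM2l// hN.
Qed.

Lemma bounded_mfun_sum t (I : Type) (r : seq I) (h : I -> R -> R) :
  (forall i, bounded_mfun t (h i)) -> bounded_mfun t (fun s => \sum_(i <- r) h i s).
Proof.
move=> hh; elim: r => [|i r IH].
  under eq_fun do rewrite big_nil; split; first exact: measurable_cst.
  by exists 0 => s _; rewrite normr0.
by under eq_fun do rewrite big_cons; exact: bounded_mfunD.
Qed.

(** The Riemann-Liouville fractional integral of order [a] with base point 0. *)
Definition frac_integral (a : R) (h : R -> R) (t : R) : R :=
  (Gamma a)^-1 * \int[mu]_(s in `]0, t[) ((t - s) `^ (a - 1) * h s).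

Lemma frac_integral0 a h : frac_integral a h 0 = 0.
Proof. by rewrite /frac_integral set_itvoo0 Rintegral_set0 mulr0. Qed.

Lemma integrable_frac_integral a t h : 0 < a -> 0 < t -> bounded_mfun t h ->
  mu.-integrable `]0, t[ (EFin \o (fun s => (t - s) `^ (a - 1) * h s)).
Proof.
move=> a0 t0 [mh [M hM]].
have ik := integrable_conv_powR a0 t0.
apply: (le_integrable (mitv 0 t) _ _ (integrableZl (mitv 0 t) M ik)).
  apply/measurable_EFinP; apply: measurable_funM; last exact: mh.
  by apply/measurable_EFinP; exact: (measurable_int mu).
move=> s /= st; rewrite lee_fin [in leRHS]mulrC !normrM ler_wpM2l//.
by rewrite (le_trans (hM _ st))// ler_norm.
Qed.

Lemma frac_integralD a t g h : 0 < a -> 0 < t -> bounded_mfun t g -> bounded_mfun t h ->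
  frac_integral a (fun s => g s + h s) t = frac_integral a g t + frac_integral a h t.
Proof.
move=> a0 t0 bg bh; rewrite /frac_integral -mulrDr; congr (_ * _).
rewrite -(RintegralD (mitv 0 t) (integrable_frac_integral a0 t0 bg)
  (integrable_frac_integral a0 t0 bh)).
by apply: eq_Rintegral => s _; rewrite mulrDr.
Qed.

Lemma frac_integralZ a t c h : 0 < a -> 0 < t -> bounded_mfun t h ->
  frac_integral a (fun s => c * h s) t = c * frac_integral a h t.
Proof.
move=> a0 t0 bh; rewrite /frac_integral mulrCA; congr (_ * _).
rewrite -(RintegralZl c (mitv 0 t) (integrable_frac_integral a0 t0 bh)).
by apply: eq_Rintegral => s _; rewrite mulrCA.
Qed.

Lemma frac_integral_sum a t (I : Type) (r : seq I) (h : I -> R -> R) : 0 < a -> 0 < t ->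
  (forall i, bounded_mfun t (h i)) ->
  frac_integral a (fun s => \sum_(i <- r) h i s) t = \sum_(i <- r) frac_integral a (h i) t.
Proof.
move=> a0 t0 hh; elim: r => [|i r IH].
  rewrite big_nil; under eq_fun do rewrite big_nil.
  rewrite /frac_integral; under eq_Rintegral do rewrite mulr0.
  by rewrite Rintegral_cst// mul0r mulr0.
rewrite big_cons -IH; under eq_fun do rewrite big_cons.
by rewrite frac_integralD//; exact: bounded_mfun_sum.
Qed.

Lemma frac_integral_norm_le a t g h : 0 < a -> 0 < t -> bounded_mfun t g -> bounded_mfun t h ->
  (forall s, s \in `]0, t[ -> `|g s| <= h s) -> `|frac_integral a g t| <= frac_integral a h t.
Proof.
move=> a0 t0 bg bh gh.
have G0 : 0 <= (Gamma a)^-1 by rewrite invr_ge0 ltW// Gamma_gt0.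
rewrite /frac_integral normrM (ger0_norm G0) ler_wpM2l//.
have ig := integrable_frac_integral a0 t0 bg.
apply: (le_trans (le_normr_Rintegral (mitv 0 t) ig)).
apply: (le_Rintegral (mitv 0 t) _ (integrable_frac_integral a0 t0 bh)).
  by have := integrable_abse ig.
by move=> s st; rewrite normrM ger0_norm ?powR_ge0// ler_wpM2l ?powR_ge0// gh.
Qed.

Definition power_term (a t : R) (i : nat) : R := (t `^ a) ^+ i / Gamma (i%:R * a + 1).

Lemma power_term_ge0 a t i : 0 < a -> 0 <= power_term a t i.
Proof.
move=> a0; rewrite divr_ge0 ?exprn_ge0 ?powR_ge0// ltW// Gamma_gt0//.
by rewrite ltr_wpDl// mulr_ge0// ltW.
Qed.

Lemma power_term0 a t : power_term a t 0 = 1.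
Proof. by rewrite /power_term mul0r add0r Gamma1 divr1. Qed.

Lemma bounded_mfun_power_term a t i : 0 < a -> bounded_mfun t (power_term a ^~ i).
Proof.
move=> a0; split.
  apply: measurable_funTS; apply: measurable_funM; last exact: measurable_cst.
  by apply: measurable_funX; exact: measurable_powR.
have G0 : 0 < Gamma (i%:R * a + 1).
  by rewrite Gamma_gt0// ltr_wpDl// mulr_ge0// ltW.
exists (power_term a t i) => s; rewrite in_itv/= => /andP[s0 st].
rewrite ger0_norm ?power_term_ge0// ler_wpM2r ?invr_ge0 ?(ltW G0)//.
by rewrite lerXn2r ?nnegrE ?powR_ge0// ge0_ler_powR ?nnegrE ?ltW// (lt_trans s0).
Qed.

Lemma frac_integral_power_term (a t : R) i : 0 < a -> 0 <= t ->
  frac_integral a (power_term a ^~ i) t = power_term a t i.+1.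
Proof.
move=> a0; rewrite le_eqVlt => /predU1P[<-|t0].
  by rewrite frac_integral0 /power_term powR0 ?gt_eqF// expr0n mul0r.
have ia0 : 0 <= i%:R * a by rewrite mulr_ge0// ltW.
have Ga := Gamma_gt0 a0.
have Gi : 0 < Gamma (i%:R * a + 1) by rewrite Gamma_gt0// ltr_wpDl.
have xE s n : 0 <= s -> (s `^ a) ^+ n = s `^ (n%:R * a).
  by move=> s0; rewrite mulrC powRrM powR_mulrn// powR_ge0.
have bs : bounded_mfun t (fun s => s `^ (i%:R * a)).
  split; first by apply: measurable_funTS; exact: measurable_powR.
  exists (t `^ (i%:R * a)) => s; rewrite in_itv/= => /andP[s0 st].
  rewrite ger0_norm ?powR_ge0//; apply: ge0_ler_powR => //.
  - by rewrite nnegrE ltW.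
  - by rewrite nnegrE ltW.
  - exact: ltW.
transitivity (frac_integral a (fun s => (Gamma (i%:R * a + 1))^-1 * s `^ (i%:R * a)) t).
  rewrite /frac_integral; congr (_ * _).
  apply: eq_Rintegral => s; rewrite inE/= in_itv/= => /andP[s0 st].
  by rewrite /power_term xE ?ltW// [_^-1 * _]mulrC.
rewrite frac_integralZ// /frac_integral {1}/Rintegral integral_conv_powR//=.
have iSa : i.+1%:R * a = a + i%:R * a by rewrite -natr1 mulrDl mul1r addrC.
have GS : 0 < Gamma (a + i%:R * a + 1) by rewrite Gamma_gt0// ltr_wpDl// addr_ge0// ltW.
rewrite /power_term xE ?ltW// iSa.
move: (Gamma a) (Gamma (i%:R * a + 1)) (Gamma (a + i%:R * a + 1)) (t `^ _) Ga Gi GS.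
by move=> x y z w x0 y0 z0; field; rewrite !gt_eqF.
Qed.

(** The fractional integral of the Caputo derivative is the integral of the
    derivative, by Abel's inversion, hence the increment of [f]. *)
Lemma caputo_volterra (a : R) (f h : R -> R) : 0 < a <= 1 ->
  caputo_derivable a f ->
  (forall t, 0 < t -> caputo a f t = h t) ->
  (forall t, 0 < t -> bounded_mfun t h) ->
  forall t, 0 <= t -> f t = f 0 + frac_integral a h t.
Proof.
move=> /andP[a0 a1] [f0 df ik] fh bh t.
rewrite le_eqVlt => /predU1P[<-|t0]; first by rewrite frac_integral0 addr0.
suff [idf H] : mu.-integrable `]0, t[ (EFin \o derive1 f) /\
    frac_integral a h t = \int[mu]_(s in `]0, t[) derive1 f s.
  rewrite H -(@integral_derive1 R f 0 t)//; first by rewrite addrC subrK.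
  - move=> x x0 _; apply: cvg_at_left_filter.
    by apply/differentiable_continuous/derivable1_diffP; exact: df.
  - by move=> x; rewrite in_itv/= => /andP[x0 _]; exact: df.
have [aE|an1] := eqVneq a 1.
  have hE s : s \in `]0, t[ -> h s = derive1 f s.
    by rewrite in_itv/= => /andP[s0 _]; rewrite -fh// /caputo aE eqxx.
  split.
    have [mh [M hM]] := bh t t0; have ih := itv_bounded_integrable mh hM.
    by apply: (eq_integrable (mitv 0 t) _ _ _ ih) => s; rewrite inE => st /=; rewrite hE.
  rewrite /frac_integral aE Gamma1 invr1 mul1r; apply: eq_Rintegral => s; rewrite inE => st.
  by rewrite subrr powRr0 mul1r hE.
have a01 : 0 < a < 1 by rewrite a0 lt_neqAle an1.
have ik' := ik an1.
split; first exact: integrable_of_abel_kernel (ik' t t0).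
have G1 : 0 < Gamma (1 - a) by rewrite Gamma_gt0// subr_gt0 lt_neqAle an1.
have G0 := Gamma_gt0 a0.
have := abel_inversion a01 t0 ik' => AI.
transitivity ((Gamma a)^-1 * ((Gamma (1 - a))^-1 *
  (Gamma a * Gamma (1 - a) * \int[mu]_(r in `]0, t[) derive1 f r))); last first.
  move: (Gamma a) (Gamma (1 - a)) G0 G1 => x y x0 y0.
  by field; rewrite !gt_eqF.
rewrite -AI /frac_integral; congr (_ * _).
rewrite -RintegralZl//; last first.
  have ih := integrableZl (mitv 0 t) (Gamma (1 - a)) (integrable_frac_integral a0 t0 (bh t t0)).
  apply: (eq_integrable (mitv 0 t) _ _ _ ih) => s.
  rewrite inE/= in_itv/= => /andP[s0 st].
  rewrite -fh// /caputo (negbTE an1) -EFinM; congr EFin.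
  by rewrite mulrCA; congr (_ * _); rewrite mulrA mulfV ?mul1r ?gt_eqF.
apply: eq_Rintegral => s; rewrite inE/= in_itv/= => /andP[s0 st].
by rewrite -fh// /caputo (negbTE an1) mulrCA.
Qed.

(** The [m]-th component of [A ^ i u0] for the lower triangular matrix [A]. *)
Fixpoint system_coef (A : nat -> nat -> R) (u0 : nat -> R) (i m : nat) : R :=
  if i is i'.+1 then \sum_(j < m.+1) A m j * system_coef A u0 i' j else u0 m.

Definition system_partial_sum A u0 (a t : R) (N m : nat) : R :=
  \sum_(0 <= i < N) system_coef A u0 i m * power_term a t i.

(** The errors of consecutive partial sums satisfy the homogeneous Volterra
    equations, so each step of the induction integrates the previous bound
    once more and gains a factor [K]. *)
Lemma system_error_le (a : R) (A : nat -> nat -> R) (u0 : nat -> R)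
    (u : nat -> R -> R) (M : nat) (K : R) :
  0 < a -> 0 <= K ->
  (forall m, (m <= M)%N -> \sum_(j < m.+1) `|A m j| <= K) ->
  (forall m t, 0 <= t -> `|u m t| <= 1) ->
  (forall m t, measurable_fun (`]0, t[ : set R) (u m)) ->
  (forall m t, 0 <= t -> u m t = u0 m +
     frac_integral a (fun s => \sum_(j < m.+1) A m j * u j s) t) ->
  forall N m t, (m <= M)%N -> 0 <= t ->
    `|u m t - system_partial_sum A u0 a t N m| <= K ^+ N * power_term a t N.
Proof.
move=> a0 K0 AK u1 mu_ uE.
have bu m t : bounded_mfun t (u m).
  split; first exact: mu_.
  by exists 1 => s; rewrite in_itv/= => /andP[s0 _]; rewrite u1// ltW.
have bp N m t : bounded_mfun t (fun s => system_partial_sum A u0 a s N m).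
  apply: bounded_mfun_sum => i; apply: bounded_mfunZ; exact: bounded_mfun_power_term.
elim=> [|N IH] m t mM t0.
  by rewrite /system_partial_sum big_geq// subr0 expr0 mul1r power_term0 u1.
move: t0; rewrite le_eqVlt => /predU1P[<-|t0].
  rewrite uE// frac_integral0 addr0 /system_partial_sum big_nat_recl//= power_term0 mulr1.
  rewrite big1 ?addr0 ?subrr ?normr0 => [|i _].
    by apply: mulr_ge0; [exact: exprn_ge0|exact: power_term_ge0].
  by rewrite /power_term powR0 ?gt_eqF// expr0n mul0r mulr0.
have -> : u m t - system_partial_sum A u0 a t N.+1 m =
    frac_integral a (fun s => \sum_(j < m.+1) A m j *
      (u j s + (- 1) * system_partial_sum A u0 a s N j)) t.
  have bA j : bounded_mfun t (fun s => A m j * u j s) by exact: bounded_mfunZ.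
  have fp j : frac_integral a (fun s => system_partial_sum A u0 a s N j) t =
      \sum_(0 <= i < N) system_coef A u0 i j * power_term a t i.+1.
    rewrite /system_partial_sum frac_integral_sum//; last first.
      by move=> i; apply: bounded_mfunZ; exact: bounded_mfun_power_term.
    apply: eq_bigr => i _; rewrite frac_integralZ//; last exact: bounded_mfun_power_term.
    by rewrite frac_integral_power_term// ltW.
  rewrite uE ?(ltW t0)// !frac_integral_sum//; last first.
    move=> j; apply: bounded_mfunZ; apply: bounded_mfunD => //; exact: bounded_mfunZ.
  rewrite {1}/system_partial_sum big_nat_recl//= power_term0 mulr1.
  rewrite opprD addrACA subrr add0r.
  under [X in _ - X]eq_bigr do rewrite mulr_suml.
  rewrite exchange_big/= -sumrB; apply: eq_bigr => j _.
  rewrite frac_integralZ// frac_integralZ//; last first.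
    by apply: bounded_mfunD => //; exact: bounded_mfunZ.
  rewrite frac_integralD//; last exact: bounded_mfunZ.
  rewrite frac_integralZ// mulN1r mulrBr fp; congr (_ - _).
  by rewrite mulr_sumr; apply: eq_bigr => i _; rewrite -mulrA.
have -> : K ^+ N.+1 * power_term a t N.+1 =
    frac_integral a (fun s => K ^+ N.+1 * power_term a s N) t.
  rewrite frac_integralZ//; last exact: bounded_mfun_power_term.
  by rewrite frac_integral_power_term// ltW.
apply: frac_integral_norm_le => //.
- apply: bounded_mfun_sum => j; apply: bounded_mfunZ; apply: bounded_mfunD => //.
  exact: bounded_mfunZ.
- by apply: bounded_mfunZ; exact: bounded_mfun_power_term.
move=> s; rewrite in_itv/= => /andP[s0 st].
apply: (le_trans (ler_norm_sum _ _ _)).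
apply: (@le_trans _ _ (\sum_(j < m.+1) `|A m j| * (K ^+ N * power_term a s N))).
  apply: ler_sum => j _; rewrite normrM ler_wpM2l// mulN1r IH ?ltW//.
  by rewrite (leq_trans _ mM)// -ltnS.
rewrite -mulr_suml exprS -mulrA ler_wpM2r ?AK//.
by rewrite mulr_ge0 ?exprn_ge0 ?power_term_ge0.
Qed.

(** Applied to [M] with [M ^ a > 2 K t ^ a], the lower bound on Gamma beats
    both the geometric factor and 2 ^ N. *)
Lemma power_term_decay (a t K : R) : 0 < a -> 0 <= t -> 0 <= K ->
  exists C, forall N, K ^+ N * power_term a t N <= C / 2 ^+ N.
Proof.
move=> a0 t0 K0.
pose L := 2 * K * t `^ a + 1.
have L0 : 0 < L by rewrite ltr_wpDl// !mulr_ge0// powR_ge0.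
pose M := L `^ a^-1.
have M0 : 0 < M by exact: powR_gt0.
have Ma : M `^ a = L by rewrite -powRrM mulVf ?gt_eqF// powRr1// ltW.
exists (expR (M + 1)) => N.
have Na0 : 0 <= N%:R * a by rewrite mulr_ge0// ltW.
have G0 : 0 < Gamma (N%:R * a + 1) by rewrite Gamma_gt0// ltr_wpDl.
have G1 : L ^+ N * expR (- (M + 1)) <= Gamma (N%:R * a + 1).
  have ME : M `^ (N%:R * a) = L ^+ N by rewrite mulrC powRrM Ma powR_mulrn// ltW.
  by have := @Gamma_ge _ (N%:R * a + 1) M; rewrite lerDr addrK ME; apply.
rewrite /power_term mulrA -exprMn ler_pdivrMr// mulrAC.
rewrite ler_pdivlMr ?exprn_gt0// -exprMn.
apply: (@le_trans _ _ (L ^+ N)).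
  rewrite lerXn2r ?nnegrE ?(ltW L0)// ?mulr_ge0 ?powR_ge0//.
  by rewrite /L mulrC mulrA lerDl.
by rewrite -ler_pdivrMl ?expR_gt0// -expRN mulrC.
Qed.

Lemma system_power_series_cvg (a : R) (A : nat -> nat -> R) (u0 : nat -> R) (u : nat -> R -> R) :
  0 < a ->
  (forall m t, 0 <= t -> `|u m t| <= 1) ->
  (forall m t, measurable_fun (`]0, t[ : set R) (u m)) ->
  (forall m t, 0 <= t -> u m t = u0 m +
     frac_integral a (fun s => \sum_(j < m.+1) A m j * u j s) t) ->
  forall m t, 0 <= t -> system_partial_sum A u0 a t N m @[N --> \oo] --> u m t.
Proof.
move=> a0 u1 mu_ uE M t t0.
pose K := \sum_(m < M.+1) \sum_(j < m.+1) `|A m j|.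
have Am0 m : 0 <= \sum_(j < m.+1) `|A m j| by exact: sumr_ge0.
have K0 : 0 <= K by apply: sumr_ge0 => i _; exact: Am0.
have AK m : (m <= M)%N -> \sum_(j < m.+1) `|A m j| <= K.
  move=> mM; rewrite /K (bigD1 (Ordinal (n := M.+1) (m := m) mM))//= lerDl.
  by apply: sumr_ge0 => i _; exact: Am0.
have [C HC] := power_term_decay a0 t0 K0.
have err N : `|u M t - system_partial_sum A u0 a t N M| <= C / 2 ^+ N.
  by apply: le_trans (HC N); exact: (system_error_le a0 K0 AK u1 mu_ uE).
have geo : C / 2 ^+ N @[N --> \oo] --> (0 : R).
  have h : `|2^-1 : R| < 1 by rewrite ger0_norm ?invf_lt1// ltr1n.
  have := cvg_geometric C h; apply: cvg_trans; apply: near_eq_cvg.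
  by near=> N; rewrite /geometric/= exprVn.
apply/cvgrPdist_le => e e0; near=> N; apply: (le_trans (err N)).
by near: N; apply: (cvgr_le _ geo).
Unshelve. all: by end_near. Qed.

Lemma is_cvg_power_series (a t K : R) (c : nat -> R) : 0 < a -> 0 <= t -> 0 <= K ->
  (forall i, `|c i| <= K ^+ i) ->
  cvgn (fun N => \sum_(0 <= i < N) c i * power_term a t i).
Proof.
move=> a0 t0 K0 cK.
have [C HC] := power_term_decay a0 t0 K0.
have C0 : 0 <= C.
  by have := HC 0%N; rewrite !expr0 divr1 mul1r; apply: le_trans; exact: power_term_ge0.
have h : `|2^-1 : R| < 1 by rewrite ger0_norm ?invf_lt1// ltr1n.
apply: normed_cvg.
apply: (@series_le_cvg _ _ (geometric C 2^-1)); last exact: is_cvg_geometric_series.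
- by move=> i; exact: normr_ge0.
- by move=> i; rewrite /geometric/= mulr_ge0// exprn_ge0.
- move=> i; rewrite /geometric/= exprVn normrM (ger0_norm (power_term_ge0 _ _ _))//.
  by apply: le_trans (HC i); rewrite ler_wpM2r ?power_term_ge0.
Qed.

End riemann_liouville.

(** * Symmetric polynomials, jump paths and the sets Theta and Omega *)
Section hcoef.
Variable R : fieldType.

(** [hcoef v r i] is [(- 1) ^ (i - r) h_(i - r) (v 0, ..., v r)], with [h] the
    complete homogeneous symmetric polynomial (0 when [i < r]).  The recurrence
    is the one along a path: the chain is in its last state [r], which it
    leaves at rate [v r] and enters from state [r - 1]. *)
Fixpoint hcoef (v : nat -> R) (r i : nat) : R :=
  if i is i'.+1 then
    (if r is r'.+1 then hcoef v r' i' else 0) - v r * hcoef v r i'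
  else (r == 0%N)%:R.

Lemma eq_hcoef (v w : nat -> R) r i :
  (forall l, (l <= r)%N -> v l = w l) -> hcoef v r i = hcoef w r i.
Proof.
elim: i r => [//|i IH] r vw /=; rewrite vw// (IH r)//; congr (_ - _).
by case: r vw => // r vw; rewrite (IH r)// => l lr; apply: vw; exact: leqW.
Qed.

Lemma hcoef_small (v : nat -> R) r i : (i < r)%N -> hcoef v r i = 0.
Proof.
elim: i r => [|i IH] [|r]//= ir.
by rewrite !IH ?mulr0 ?subr0// ltnW.
Qed.

(** The exponents of the monomials summed over Omega: the first one is free,
    the others are positive. *)
Fixpoint exponents (r i : nat) : seq (seq nat) :=
  if r is r'.+1 then [seq rcons s j | j <- iota 1 i, s <- exponents r' (i - j)]
  else [:: [:: i]].

Definition exponent_sum (v : nat -> R) r i : R :=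
  \sum_(s <- exponents r i) \prod_(l < r.+1) v l ^+ nth 0%N s l.

Lemma size_exponents r i s : s \in exponents r i -> size s = r.+1.
Proof.
elim: r i s => [|r IH] i s; first by rewrite inE => /eqP ->.
by case/allpairsPdep => j [s' [_ /IH ss ->]]; rewrite size_rcons ss.
Qed.

Lemma exponent_sumS v r i : exponent_sum v r.+1 i =
  \sum_(1 <= j < i.+1) v r.+1 ^+ j * exponent_sum v r (i - j).
Proof.
rewrite /exponent_sum /= big_allpairs_dep/= /index_iota subSS subn0.
apply: eq_bigr => j _; rewrite mulr_sumr !big_seq; apply: eq_bigr => s /size_exponents ss.
rewrite big_ord_recr/= nth_rcons ss ltnn eqxx mulrC; congr (_ * _).
by apply: eq_bigr => l _; rewrite nth_rcons ss ltn_ord.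
Qed.

(** Either the last exponent is 1, and deleting it leaves a tuple of exponents
    for the first [r] variables, or it can be decreased. *)
Lemma exponent_sum_rec v r i :
  exponent_sum v r.+1 i.+1 = v r.+1 * (exponent_sum v r i + exponent_sum v r.+1 i).
Proof.
rewrite !exponent_sumS big_nat_recl//= subn1 expr1 mulrDr; congr (_ + _).
by rewrite mulr_sumr; apply: eq_bigr => j _; rewrite subSS exprS mulrA.
Qed.

Lemma exponent_sum0 v r : exponent_sum v r.+1 0 = 0.
Proof. by rewrite exponent_sumS big_geq. Qed.

(** Every monomial of the sum is divisible by [v 1 * ... * v r]; both sides
    then obey the same recurrence. *)
Lemma hcoefE v r i : (forall l, (0 < l <= r)%N -> v l != 0) ->
  (-1) ^+ r / \prod_(1 <= l < r.+1) v l * ((-1) ^+ i * exponent_sum v r i) = hcoef v r i.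
Proof.
elim: i r => [|i IH] [|r] v0.
- by rewrite /exponent_sum big_seq1 big_ord1 big_geq//= expr0 !mulr1 divr1.
- by rewrite exponent_sum0 !mulr0.
- rewrite [RHS]/= -IH// /exponent_sum !big_seq1 !big_ord1 big_geq//= divr1.
  by rewrite !expr0 !mul1r sub0r !exprS; ring.
- rewrite [RHS]/= -!IH//; last first.
    by move=> l /andP[l0 lr]; apply: v0; rewrite l0 leqW.
  rewrite exponent_sum_rec big_nat_recr//=.
  have vr : v r.+1 != 0 by apply: v0; rewrite ltn0Sn leqnn.
  have P0 : \prod_(1 <= l < r.+1) v l != 0.
    rewrite prodf_seq_neq0; apply/allP => l; rewrite mem_index_iota => /andP[l0 lr].
    by rewrite /= v0// l0 ltnW.
  move: (\prod_(1 <= l < r.+1) v l) P0 => p p0.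
  rewrite !exprS; field; exact/andP.
Qed.

(** The divided difference of [(- x) ^ N] at the nodes [s], up to sign. *)
Definition divided_difference (s : seq R) (N : nat) : R :=
  \sum_(x <- s) (- x) ^+ N * \prod_(y <- s | y != x) (y - x)^-1.

Lemma perm_divided_difference s1 s2 N : perm_eq s1 s2 ->
  divided_difference s1 N = divided_difference s2 N.
Proof.
move=> s12; rewrite /divided_difference (perm_big s2)//=; apply: eq_bigr => x _.
by rewrite (perm_big s2).
Qed.

Lemma divided_difference_cons z s N : uniq (z :: s) ->
  divided_difference (z :: s) N.+1 = divided_difference s N - z * divided_difference (z :: s) N.
Proof.
move=> /= /andP[zs us]; apply/eqP; rewrite eq_sym subr_eq eq_sym; apply/eqP.
rewrite /divided_difference !big_cons mulrDr addrACA.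
rewrite exprS !mulNr !mulrA addNr add0r mulr_sumr -big_split/=.
rewrite !big_seq; apply: eq_bigr => x xs.
have zx : z != x by apply: contraNneq zs => ->.
have zx0 : z - x != 0 by rewrite subr_eq0.
rewrite big_cons zx exprS; move: (\prod_(_ <- _ | _) _) => p.
by field.
Qed.

(** Removing a node [z1] or a node [z2] gives two values which differ by
    [z1 - z2] times the sum with both nodes; by induction they are equal. *)
Lemma divided_difference0 s : uniq s -> divided_difference s 0 = (size s == 1%N)%:R.
Proof.
have [n] := ubnP (size s); elim: n s => // n IH [|z1 [|z2 s]] sn us.
- by rewrite /divided_difference big_nil.
- by rewrite /divided_difference big_seq1 big_cons eqxx/= big_nil mulr1.
have p12 : perm_eq (z1 :: z2 :: s) (z2 :: z1 :: s).
  by apply/permP => p /=; rewrite addnCA.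
have us' : uniq (z2 :: z1 :: s) by rewrite -(perm_uniq p12).
have z12 : z1 - z2 != 0.
  by move: us; rewrite subr_eq0/= inE negb_or => /andP[/andP[]].
have e1 := divided_difference_cons 0 us; have := divided_difference_cons 0 us'.
rewrite -!(perm_divided_difference _ p12) e1.
move: us us' => /= /andP[_ us2] /andP[_ us1].
rewrite (IH (z2 :: s))//= (IH (z1 :: s))//= => /addrI/oppr_inj h.
by apply: (mulfI z12); rewrite mulr0 mulrBl h subrr.
Qed.

Lemma hcoef_divided_difference v r i : {in gtn r.+1 &, injective v} ->
  hcoef v r i = divided_difference [seq v l | l <- iota 0 r.+1] i.
Proof.
have uv n : {in gtn n &, injective v} -> uniq [seq v l | l <- iota 0 n].
  move=> vinj; rewrite map_inj_in_uniq ?iota_uniq// => x y.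
  by rewrite !mem_iota !add0n => /andP[_ xr] /andP[_ yr]; exact: vinj.
elim: i r => [|i IH] r vinj.
  by rewrite divided_difference0 ?uv// size_map size_iota.
have pr : perm_eq [seq v l | l <- iota 0 r.+1] (v r :: [seq v l | l <- iota 0 r]).
  by rewrite -addn1 iotaD map_cat/= add0n cats1 perm_rcons.
rewrite (perm_divided_difference _ pr) divided_difference_cons; last by rewrite -(perm_uniq pr) uv.
rewrite -(perm_divided_difference _ pr) -IH//=; congr (_ - _).
case: r vinj {pr} => [|r] vinj; first by rewrite /divided_difference big_nil.
by apply: IH => x y xr yr; apply: vinj; exact: ltnW.
Qed.
End hcoef.

Section jumps.
Local Open Scope nat_scope.

(** A jump of size [j] occupies [j] positions of the tuple: its size at the
    state it leaves, and zeros at the states it skips. *)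
Definition jump j : seq nat := j :: nseq j.-1 0.

Lemma size_jump j : 0 < j -> size (jump j) = j.
Proof. by move=> j0; rewrite /= size_nseq prednK. Qed.

(** [jumps k m] enumerates the tuples of the paths from 0 to [m] with jumps of
    size at most [k].  The recursion removes the last jump, which is not
    structural; the argument [n] is fuel. *)
Fixpoint jumps_rec (k n m : nat) : seq (seq nat) :=
  if n is n'.+1 then
    if m is 0 then [:: [::]]
    else [seq s ++ jump j | j <- iota 1 (minn m k), s <- jumps_rec k n' (m - j)]
  else [:: [::]].

Definition jumps k m := jumps_rec k m m.

Lemma jumps_recE k n m : m <= n -> jumps_rec k n m = jumps k m.
Proof.
rewrite /jumps => mn; have [p] := ubnP m.
elim: p m n mn => // p IH [|m] [|n]//= mn mp.
congr flatten; apply/eq_in_map => j; rewrite mem_iota => /andP[j1 _].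
have mj : m.+1 - j <= m by lia.
by congr map; rewrite (IH _ n) ?(IH _ m)//; lia.
Qed.

Lemma jumps0 k : jumps k 0 = [:: [::]]. Proof. by []. Qed.

Lemma jumpsS k m : 0 < m -> jumps k m =
  [seq s ++ jump j | j <- iota 1 (minn m k), s <- jumps k (m - j)].
Proof.
case: m => // m _; rewrite {1}/jumps /=.
congr flatten; apply/eq_in_map => j; rewrite mem_iota => /andP[j1 _].
by rewrite jumps_recE//; lia.
Qed.

Lemma jumpsP k m s : 0 < m -> reflect
  (exists j s', [/\ 0 < j <= m, j <= k, s' \in jumps k (m - j) & s = s' ++ jump j])
  (s \in jumps k m).
Proof.
move=> m0; rewrite jumpsS//; apply: (iffP allpairsPdep) => -[j [s' []]].
  rewrite mem_iota add1n ltnS leq_min => /and3P[j0 jm jk] ss' ->.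
  by exists j, s'; rewrite j0.
move=> /andP[j0 jm] jk ss' ->; exists j, s'; split=> //.
by rewrite mem_iota add1n ltnS leq_min j0 jm.
Qed.

Lemma size_jumps k m s : s \in jumps k m -> size s = m.
Proof.
have [n] := ubnP m; elim: n m s => // n IH [|m] s mn; first by rewrite inE => /eqP ->.
case/jumpsP => // j [s' [/andP[j0 jm] jk ss' ->]].
rewrite size_cat size_jump// (IH _ _ _ ss') ?subnK//.
by lia.
Qed.

Lemma jumps_bound k k' m : m <= k -> m <= k' -> jumps k m = jumps k' m.
Proof.
have [n] := ubnP m; elim: n m => // n IH [|m] mn mk mk'; first by [].
rewrite !jumpsS// !(minn_idPl _)//.
congr flatten; apply/eq_in_map => j; rewrite mem_iota => /andP[j1 _].
have mj : m.+1 - j <= m by lia.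
by rewrite (IH (m.+1 - j))//; lia.
Qed.

(** Two paths whose last jumps [i < i'] differ are told apart at position
    [m - i], where the first has a jump and the second a zero. *)
Lemma uniq_jumps k m : uniq (jumps k m).
Proof.
have [n] := ubnP m; elim: n m => // n IH [|m] mn; first by [].
rewrite jumpsS//; apply: allpairs_uniq_dep.
- exact: iota_uniq.
- move=> j; rewrite mem_iota => /andP[j1 _]; apply: IH.
  by lia.
move=> /= [j s] [j' s'] /allpairsPdep[i [u [ij us [-> ->]]]].
case/allpairsPdep => [i' [u' [ij' us' [-> ->]]]] /= E.
move: ij ij'; rewrite !mem_iota !add1n !ltnS !leq_min => /and3P[i0 im ik] /and3P[i0' im' ik'].
have su := size_jumps us; have su' := size_jumps us'.
suff ii : i = i'.
  subst i'; move/eqP: E; rewrite eqseq_cat ?su ?su'// => /andP[/eqP -> _].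
  by [].
wlog ii : i i' u u' us us' E i0 im ik i0' im' ik' su su' / i <= i'.
  move=> W; case/orP: (leq_total i i') => h; first exact: (W i i' u u').
  by apply/esym; exact: (W i' i u' u).
move: ii; rewrite leq_eqVlt => /predU1P[//|ii].
have := congr1 (nth 0 ^~ (m.+1 - i)) E.
rewrite nth_cat su ltnn subnn /= nth_cat su'.
rewrite ltnNge leq_sub2l ?(ltnW ii)//= -[m.+1 - i - _]prednK ?subn_gt0 ?ltn_sub2l//=.
  by rewrite nth_nseq; case: ifP => _ i00; move: i0; rewrite i00.
exact: leq_trans ii im'.
Qed.

Definition visited (s : seq nat) : seq nat :=
  rcons [seq j <- iota 0 (size s) | nth 0 s j != 0] (size s).

Lemma visited_cat s j : 0 < j -> visited (s ++ jump j) = rcons (visited s) (size s + j).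
Proof.
move=> j0; rewrite /visited size_cat size_jump//; congr rcons.
rewrite iotaD filter_cat add0n -cats1; congr (_ ++ _).
  by apply: eq_in_filter => i; rewrite mem_iota add0n => /andP[_ h]; rewrite nth_cat h.
rewrite -{2}[j]prednK//= nth_cat ltnn subnn -lt0n j0; congr cons.
apply/eqP; rewrite -size_eq0 size_filter -leqn0 leqNgt -has_count.
apply/hasPn => i; rewrite mem_iota => /andP[si sj].
rewrite nth_cat ltnNge (ltnW si)/= negbK.
by rewrite -[i - _]prednK ?subn_gt0//= nth_nseq; case: ifP.
Qed.

Lemma visited_jumps0 k m s : s \in jumps k m -> nth 0 (visited s) 0 = 0.
Proof.
have [n] := ubnP m; elim: n m s => // n IH [|m] s mn; first by rewrite inE => /eqP ->.
case/jumpsP => // j [s' [/andP[j0 jm] jk ss' ->]].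
rewrite visited_cat// nth_rcons size_rcons/=; apply: IH ss'.
by lia.
Qed.
End jumps.

Section tuples.
Local Open Scope nat_scope.

Definition row_of (n : nat) (s : seq nat) : 'rV[nat]_n := \row_(j < n) nth 0 s j.
Definition seq_of (n : nat) (x : 'rV[nat]_n) : seq nat := [seq x ord0 j | j <- enum 'I_n].

Lemma size_seq_of n (x : 'rV[nat]_n) : size (seq_of x) = n.
Proof. by rewrite size_map size_enum_ord. Qed.

Lemma nth_seq_of n (x : 'rV[nat]_n) (j : 'I_n) : nth 0 (seq_of x) j = x ord0 j.
Proof. by rewrite (nth_map j) ?size_enum_ord// nth_ord_enum. Qed.

Lemma seq_ofK n : cancel (@seq_of n) (row_of n).
Proof. by move=> x; apply/rowP => j; rewrite mxE nth_seq_of. Qed.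

Lemma row_ofK n s : size s = n -> seq_of (row_of n s) = s.
Proof.
move=> sn; apply: (@eq_from_nth _ 0); rewrite size_seq_of// => j jn.
by rewrite (nth_seq_of _ (Ordinal jn)) mxE.
Qed.

Lemma row_of_jump n i (s : seq nat) : 0 < i <= n -> size s = n - i ->
  (row_of (n - i) s *m pid_mx (n - i) + unit_row n (n - i).+1 *+ i)%R =
  row_of n (s ++ jump i).
Proof.
move=> /andP[i0 ni] ss; apply/rowP => l; rewrite !mxE nth_cat ss.
rewrite mulmxnE !mxE.
case: ltnP => l1.
  rewrite (bigD1 (Ordinal l1))//= big1 => [|p pl].
    rewrite !mxE/= eqxx l1/= eqSS (ltn_eqF l1).
    by rewrite mulr1 mul0rn !addr0.
  rewrite !mxE; have -> : (p == l :> nat) = false.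
    by apply: contraNF pl => /eqP pl; apply/eqP/val_inj.
  by rewrite mulr0.
rewrite big1 => [|p _]; last first.
  by rewrite !mxE (ltn_eqF (leq_trans (ltn_ord p) l1)) mulr0.
rewrite add0r eqSS; have [->|ln] := eqVneq (l : nat) (n - i).
  by rewrite subnn /= natn.
have l2 : 0 < l - (n - i) by rewrite subn_gt0 ltn_neqAle eq_sym ln.
by rewrite mul0rn -[l - _]prednK//= nth_nseq; case: ifP.
Qed.

(** When [k >= n] the recursion for Theta replaces [k] by [n]; no jump of a path
    of length less than [n] can tell the difference. *)
Lemma Theta_jumps n k (x : 'rV[nat]_n) : Theta n k x -> seq_of x \in jumps k n.
Proof.
elim=> {n k x} [k k1|n k i x n2 /andP[k1 kn] /andP[i1 ik] _ IH|
    n k i x n2 nk /andP[i1 ik] _ IH|n k n2 nk].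
- have -> : const_mx 1 = row_of 1 [:: 1] by apply/rowP => j; rewrite !mxE ord1.
  rewrite row_ofK//; apply/jumpsP => //; exists 1, [::]; split=> //.
- have i_n : 0 < i <= n by lia.
  rewrite -(seq_ofK x) row_of_jump ?size_seq_of// row_ofK.
    by apply/jumpsP; [lia|exists i, (seq_of x)].
  by rewrite size_cat size_seq_of size_jump; lia.
- have i_n : 0 < i <= n by lia.
  rewrite -(seq_ofK x) row_of_jump ?size_seq_of// row_ofK.
    apply/jumpsP; [lia|exists i, (seq_of x); split=> //; [lia|]].
    by rewrite (jumps_bound (k' := n))//; lia.
  by rewrite size_cat size_seq_of size_jump; lia.
- have -> : (unit_row n 1 *+ n)%R = row_of n (jump n).
    apply/rowP => l; rewrite mulmxnE !mxE eqSS.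
    case: (l : nat) (ltn_ord l) => [|p] pn; first by rewrite natn.
    by rewrite mul0rn/= nth_nseq; case: ifP.
  rewrite row_ofK ?size_jump; [|lia|lia].
  apply/jumpsP; [lia|exists n, [::]; split=> //; [lia|by rewrite subnn]].
Qed.

Lemma jumps_Theta n k s : 0 < n -> 0 < k -> s \in jumps k n -> Theta n k (row_of n s).
Proof.
have [p] := ubnP n; elim: p n k s => // p IH n k s np n0 k0.
case/jumpsP => // i [s' [/andP[i0 i_n] ik ss' ->]].
have ss := size_jumps ss'.
have [iE|inn] := eqVneq i n.
  subst i; move: ss' ss; rewrite subnn jumps0 inE => /eqP -> _; rewrite cat0s.
  have [n1|n1] := eqVneq n 1.
    subst n; have -> : row_of 1 (jump 1) = const_mx 1.
      by apply/rowP => j; rewrite !mxE ord1.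
    exact: Theta_one.
  have -> : row_of n (jump n) = (unit_row n 1 *+ n)%R.
    apply/rowP => l; rewrite mulmxnE !mxE eqSS.
    case: (l : nat) (ltn_ord l) => [|q] qn; first by rewrite natn.
    by rewrite mul0rn/= nth_nseq; case: ifP.
  by apply: Theta_top; lia.
rewrite -row_of_jump//; last by rewrite i0.
have [kn|kn] := leqP k n.-1.
  by apply: Theta_lt; [lia|lia|lia|apply: IH; lia].
apply: Theta_ge; [lia|lia|lia|apply: IH; [lia|lia|lia|]].
by rewrite (jumps_bound (k' := k))//; lia.
Qed.

Lemma Theta_rangeE m k : 0 < m -> 0 < k ->
  Theta_range m k = [set` [seq row_of m s | s <- jumps k m]].
Proof.
move=> m0 k0; rewrite /Theta_range.
have TE k' : 0 < k' -> jumps k' m = jumps k m ->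
    Theta m k' = [set` [seq row_of m s | s <- jumps k m]].
  move=> k'0 E; rewrite -E; apply/seteqP; split=> x /=.
    by move=> /Theta_jumps xj; apply/mapP; exists (seq_of x) => //; rewrite seq_ofK.
  by case/mapP => s sj ->; exact: jumps_Theta.
case: leqP => km; first exact: TE.
by apply: TE => //; apply: jumps_bound; lia.
Qed.

Lemma fsbig_row_of (R : zmodType) n (L : seq (seq nat)) (F : 'rV[nat]_n -> R) :
  uniq L -> (forall s, s \in L -> size s = n) ->
  (\sum_(x \in [set` [seq row_of n s | s <- L]]) F x = \sum_(s <- L) F (row_of n s))%R.
Proof.
move=> uL sL; rewrite -fsbig_seq ?big_map//.
rewrite map_inj_in_uniq// => s1 s2 /sL h1 /sL h2 h.
by rewrite -(row_ofK h1) h row_ofK.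
Qed.

(** A path never skips its starting state, so dropping the positions
    [1 <= j < m] with a zero keeps exactly the visited states. *)
Lemma val_enum_Lambda m k s : 0 < m -> s \in jumps k m ->
  [seq val j | j <- enum (Lambda (row_of m s))] = visited s.
Proof.
move=> m0 sj; have ss := size_jumps sj.
have s0 : nth 0 s 0 != 0.
  have := visited_jumps0 sj; rewrite /visited ss; case: m m0 ss {sj} => // m _ ss /=.
  case: ifP => // s0; case E : [seq j <- _ | _] => [|y t]//= y0.
  have : y \in [seq j <- iota 1 m | nth 0 s j != 0] by rewrite E mem_head.
  by rewrite mem_filter mem_iota y0 andbF.
pose P j := (j == m) || (nth 0 s j != 0).
have PL (j : 'I_m.+1) : (j \in Lambda (row_of m s)) = P (val j).
  rewrite /Lambda !inE andbT /P; apply/idP/idP => [|jP].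
    apply: contraR; rewrite negb_or negbK => /andP[jm sj0].
    have jlt : val j < m by rewrite ltn_neqAle jm -ltnS ltn_ord.
    apply/imsetP; exists (Ordinal jlt); last exact: val_inj.
    rewrite inE mxE/= sj0 andbT lt0n.
    by apply: contraNneq s0 => j0; move: sj0; rewrite /= j0.
  apply/imsetP => -[i]; rewrite inE mxE => /andP[i0 /eqP si] jE.
  move: jP; rewrite jE/= si eqxx orbF => /eqP im.
  by have := ltn_ord i; rewrite im ltnn.
have -> : enum (Lambda (row_of m s)) = [seq j <- enum 'I_m.+1 | P (val j)].
  by rewrite {1}/enum_mem -enumT; apply: eq_filter => j; rewrite -PL.
rewrite -(filter_map val P) val_enum_ord /visited ss -addn1 iotaD filter_cat/=.
rewrite /P add0n eqxx/= cats1; congr rcons.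
by apply: eq_in_filter => j; rewrite mem_iota => /andP[_ jm]; rewrite ltn_eqF.
Qed.

Lemma card_Lambda m k s : 0 < m -> s \in jumps k m ->
  #|Lambda (row_of m s)| = size (visited s).
Proof. by move=> m0 sj; rewrite -(val_enum_Lambda m0 sj) size_map cardE. Qed.

Lemma enum_val_Lambda m k s (l : 'I_#|Lambda (row_of m s)|) : 0 < m -> s \in jumps k m ->
  enum_val l = nth 0 (visited s) l :> nat.
Proof.
move=> m0 sj; rewrite -(val_enum_Lambda m0 sj).
by rewrite (nth_map (enum_default l)) -?cardE.
Qed.

End tuples.

Section omega.
Local Open Scope nat_scope.

Lemma exponentsP r i s : (s \in exponents r i) = 
  [&& size s == r.+1, sumn s == i & all (leq 1) (behead s)].
Proof.
elim: r i s => [|r IH] i s.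
  case: s => [|x [|y s]]//=; rewrite inE eqseq_cons ?andbF//.
  by rewrite addn0 eqxx !andbT.
apply/allpairsPdep/idP => [[j [s' [+ + ->]]]|].
  rewrite IH mem_iota => /andP[j0 ji] /and3P[/eqP ss /eqP sm sa].
  rewrite size_rcons ss eqxx sumn_rcons sm; case: s' ss sa {sm} => //= y s' _ sa.
  by rewrite all_rcons j0 sa; lia.
case/lastP: s => // s' j; rewrite size_rcons eqSS sumn_rcons.
case: s' => [|y s'] //.
rewrite rcons_cons/= all_rcons => /and3P[ss sm /andP[j0 sa]].
exists j, (y :: s'); split=> //; first by rewrite mem_iota j0; lia.
by rewrite IH ss sa/= andbT; lia.
Qed.

Lemma uniq_exponents r i : uniq (exponents r i).
Proof.
elim: r i => // r IH i; apply: allpairs_uniq_dep; first exact: iota_uniq.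
  by move=> j _; exact: IH.
by move=> [j s] [j' s'] _ _ /= /rcons_inj[-> ->].
Qed.

Lemma sumn_seq_of n (y : 'rV[nat]_n) : sumn (seq_of y) = \sum_(j < n) y ord0 j.
Proof. by rewrite sumnE big_map big_enum. Qed.

Lemma OmegaE r i : Omega r.+1 i = [set` [seq row_of r.+1 s | s <- exponents r i]].
Proof.
have allE (y : 'rV[nat]_r.+1) : all (leq 1) (behead (seq_of y)) <->
    forall j : 'I_r.+1, (0 < j)%N -> (0 < y ord0 j)%N.
  split=> [/(all_nthP 0) h [[//|j] jr] _|h].
    have := h j; rewrite size_behead size_seq_of => /(_ jr).
    by rewrite nth_behead (nth_seq_of y (Ordinal jr)).
  apply/(all_nthP 0) => j; rewrite size_behead size_seq_of/= => jr.
  by rewrite nth_behead (nth_seq_of y (Ordinal (jr : j.+1 < r.+1))); exact: h.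
apply/seteqP; split=> y /=.
  move=> [sy py]; apply/mapP; exists (seq_of y); last by rewrite seq_ofK.
  by rewrite exponentsP size_seq_of eqxx sumn_seq_of sy eqxx; apply/allE.
case/mapP => s sP ->; have ss := size_exponents sP.
move: sP; rewrite -{1}(row_ofK ss) exponentsP => /and3P[_ /eqP sm /allE sa].
by split=> //; rewrite -sumn_seq_of.
Qed.

Lemma exponent_sum_fsbig (R : fieldType) n i (v : nat -> R) : 0 < n ->
  (\sum_(y \in Omega n i) \prod_(l < n) v l ^+ y ord0 l = exponent_sum v n.-1 i)%R.
Proof.
case: n => // r _; rewrite OmegaE fsbig_row_of ?uniq_exponents//; last exact: size_exponents.
by apply: eq_bigr => s _; apply: eq_bigr => l _; rewrite mxE.
Qed.
End omega.

Section paths.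
Variables (R : realType) (k n0 : nat) (lam : nat -> nat -> R).
Hypothesis hlam0 : forall n, (n0 <= n)%N -> lam n 0%N = 1.

Definition out_rate (m : nat) : R := \sum_(1 <= i < k.+1) lam (n0 + m)%N i.

Definition generator (m j : nat) : R :=
  if j == m then - out_rate m
  else if (m - j <= k)%N then lam (n0 + j)%N (m - j)%N else 0.

Definition path_weight (s : seq nat) : R := \prod_(j < size s) lam (n0 + j)%N (nth 0%N s j).
Definition path_rate (s : seq nat) (l : nat) : R := out_rate (nth 0%N (visited s) l).
Definition path_coef (s : seq nat) (i : nat) : R :=
  hcoef (path_rate s) (size (visited s)).-1 i.

Lemma generator_sum (m : nat) (F : nat -> R) :
  \sum_(j < m.+1) generator m j * F j =
  - out_rate m * F m + \sum_(1 <= i < (minn m k).+1) lam (n0 + (m - i))%N i * F (m - i)%N.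
Proof.
rewrite big_ord_recr/= /generator eqxx addrC; congr (_ + _).
under eq_bigr => j _ do rewrite (ltn_eqF (ltn_ord j)).
rewrite -(big_mkord xpredT (fun j =>
  (if (m - j <= k)%N then lam (n0 + j)%N (m - j)%N else 0) * F j)).
rewrite big_nat_rev/= add0n.
rewrite (big_nat_widen 1 (minn m k).+1 m.+1) ?ltnS ?geq_minl//.
rewrite big_add1/=.
rewrite [RHS]big_mkcond/= !big_nat; apply: eq_bigr => j /andP[_ jm].
rewrite subKn// ltnS leq_min jm/=; case: ifP => // _.
by rewrite mul0r.
Qed.

Lemma path_weight_cat s j : (0 < j)%N ->
  path_weight (s ++ jump j) = path_weight s * lam (n0 + size s)%N j.
Proof.
move=> j0; rewrite /path_weight size_cat size_jump// big_split_ord/=; congr (_ * _).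
  by apply: eq_bigr => l _; rewrite nth_cat ltn_ord.
case: j j0 => // j _; rewrite big_ord_recl/= nth_cat addn0 ltnn subnn/=.
rewrite big1 ?mulr1// => l _.
rewrite nth_cat ltnNge leq_addr/= addKn/= nth_nseq ltn_ord.
by apply: hlam0; exact: leq_addr.
Qed.

(** The last state of the path is [m]: the recurrence of [hcoef] singles it
    out. *)
Lemma path_coef_cat m s j i : s \in jumps k (m - j)%N -> (0 < j <= m)%N ->
  path_coef (s ++ jump j) i.+1 = path_coef s i - out_rate m * path_coef (s ++ jump j) i.
Proof.
move=> sj /andP[j0 jm]; have ss := size_jumps sj.
rewrite /path_coef visited_cat// size_rcons /=.
have [r rE] : exists r, size (visited s) = r.+1 by rewrite /visited size_rcons; eexists.
rewrite rE; congr (_ - _ * _).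
  apply: eq_hcoef => l lr; rewrite /path_rate visited_cat// nth_rcons rE ltnS.
  by rewrite lr.
by rewrite /path_rate visited_cat// nth_rcons rE ltnn eqxx ss subnK.
Qed.

(** Grouping the paths by their last jump gives the recurrence for the powers
    of the generator. *)
Lemma path_sum i m :
  \sum_(s <- jumps k m) path_weight s * path_coef s i =
  system_coef generator (fun m => (m == 0%N)%:R) i m.
Proof.
elim: i m => [|i IH] m.
  case: m => [|m].
    by rewrite big_seq1 /path_weight big_ord0 mul1r.
  rewrite /= big_seq big1// => s /jumpsP-/(_ isT)[j [s' [/andP[j0 _] _ _ ->]]].
  by rewrite /path_coef visited_cat// size_rcons /visited size_rcons/= mulr0.
rewrite /= generator_sum -!IH.
case: m => [|m].
  rewrite min0n big_geq// addr0 !big_seq1 /path_weight big_ord0 !mul1r.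
  by rewrite /path_coef/= sub0r mulNr.
rewrite {1}jumpsS// big_allpairs_dep /index_iota subSS subn0.
transitivity (\sum_(j <- iota 1 (minn m.+1 k)) \sum_(s <- jumps k (m.+1 - j))
  (lam (n0 + (m.+1 - j))%N j * (path_weight s * path_coef s i) -
  out_rate m.+1 * (path_weight (s ++ jump j) * path_coef (s ++ jump j) i))).
  rewrite !big_seq; apply: eq_bigr => j; rewrite mem_iota => /andP[j0 jm].
  rewrite !big_seq; apply: eq_bigr => s sj.
  rewrite (path_coef_cat _ sj); last by rewrite j0; lia.
  by rewrite path_weight_cat// (size_jumps sj); ring.
under eq_bigr do rewrite sumrB.
rewrite sumrB [RHS]addrC mulNr; congr (_ - _).
  by apply: eq_bigr => j _; rewrite -IH mulr_sumr.
rewrite [in RHS]jumpsS// big_allpairs_dep mulr_sumr; apply: eq_bigr => j _.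
by rewrite mulr_sumr.
Qed.

End paths.

(** * From the process to the series *)
Section assembly.
Variable R : realType.

Lemma mittag_leffler_cvg (a t c : R) : 0 < a -> 0 <= t ->
  (\sum_(0 <= i < N) (- c) ^+ i * power_term a t i) @[N --> \oo] -->
    mittag_leffler a (- c * t `^ a).
Proof.
move=> a0 t0.
have cv : cvgn (fun N => \sum_(0 <= i < N) (- c) ^+ i * power_term a t i).
  apply: (@is_cvg_power_series _ _ _ `|c|) => // i.
  by rewrite normrX normrN.
have -> : mittag_leffler a (- c * t `^ a) =
    limn (fun N => \sum_(0 <= i < N) (- c) ^+ i * power_term a t i).
  rewrite /mittag_leffler; congr (limn _); apply/funext => N.
  by rewrite /series/=; apply: eq_bigr => i _; rewrite exprMn /power_term mulrA.
exact: cv.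
Qed.

Lemma norm_hcoef_le (v : nat -> R) (K : R) r i : 0 <= K ->
  (forall l, (l <= r)%N -> `|v l| <= K) -> `|hcoef v r i| <= (K + 1) ^+ i.
Proof.
move=> K0; elim: i r => [|i IH] r vK /=.
  by case: (r == 0%N); rewrite ?normr1 ?normr0.
have p0 : 0 <= (K + 1) ^+ i by rewrite exprn_ge0// addr_ge0.
apply: (le_trans (ler_normB _ _)); rewrite exprS mulrDl mul1r addrC lerD//.
  by rewrite normrM ler_pM// ?vK ?IH.
case: r vK => [|r] vK; first by rewrite normr0.
by apply: IH => l lr; apply: vK; exact: leqW.
Qed.

Lemma cvg_sum_seq (I : eqType) (L : seq I) (f : I -> nat -> R) (l : I -> R) :
  (forall i, i \in L -> f i N @[N --> \oo] --> l i) ->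
  (\sum_(i <- L) f i N) @[N --> \oo] --> \sum_(i <- L) l i.
Proof.
elim: L => [|i L IH] fl.
  under eq_fun do rewrite big_nil; rewrite big_nil; exact: cvg_cst.
under eq_fun do rewrite big_cons; rewrite big_cons; apply: cvgD.
  by apply: fl; exact: mem_head.
by apply: IH => j jL; apply: fl; rewrite inE jL orbT.
Qed.

Section path.
Variables (k n0 : nat) (lam : nat -> nat -> R).
Hypothesis hk : (1 <= k)%N.
Hypothesis hlam : forall n i, (n0 <= n)%N -> (1 <= i <= k)%N -> 0 < lam n i.
Hypothesis hlam0 : forall n, (n0 <= n)%N -> lam n 0%N = 1.
Variable a : R.
Hypothesis a0 : 0 < a.

Definition path_partial (s : seq nat) (t : R) (N : nat) : R :=
  \sum_(0 <= i < N) path_coef k n0 lam s i * power_term a t i.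

Lemma is_cvg_path s t : 0 <= t -> cvgn (path_partial s t).
Proof.
move=> t0.
pose K := \sum_(l < size (visited s)) `|path_rate k n0 lam s l|.
have K0 : 0 <= K by apply: sumr_ge0.
apply: (@is_cvg_power_series _ _ _ (K + 1)) => //; first by rewrite addr_ge0.
move=> i; apply: norm_hcoef_le => // l lr.
have lv : (l < size (visited s))%N.
  by move: lr; rewrite /visited size_rcons.
by rewrite /K (bigD1 (Ordinal lv))//= lerDl sumr_ge0.
Qed.

Lemma out_rate_gt0 j : 0 < out_rate k n0 lam j.
Proof.
rewrite /out_rate big_nat_recr//=; apply: ltr_wpDl; last first.
  by apply: hlam; [exact: leq_addr|rewrite hk leqnn].
rewrite big_nat_cond; apply: sumr_ge0 => i /andP[/andP[i1 ik] _]; apply: ltW.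
by apply: hlam; [exact: leq_addr|rewrite i1 ltnW].
Qed.

Lemma mu_path_rate m s (l : 'I_#|Lambda (row_of m s)|) : (0 < m)%N -> s \in jumps k m ->
  mu lam k n0 l = path_rate k n0 lam s l.
Proof.
move=> m0 sj; rewrite /mu /path_rate /out_rate.
by apply: eq_bigr => i _; rewrite (enum_val_Lambda _ m0 sj).
Qed.

(** The terms of index less than the number of jumps vanish, so the summation
    may as well start at 0. *)
Lemma series_term_path m s t N : (0 < m)%N -> s \in jumps k m ->
  ((-1) ^+ #|Lambda (row_of m s)|.-1 /
     \prod_(l < #|Lambda (row_of m s)| | (0 < l)%N) mu lam k n0 l) *
  \sum_(#|Lambda (row_of m s)|.-1 <= i < N) series_term a lam k n0 (row_of m s) t i =
  path_partial s t N.
Proof.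
move=> m0 sj; have cL := card_Lambda m0 sj.
set n := #|_| in cL *.
have n0' : (0 < n)%N by rewrite cL /visited size_rcons.
pose v := path_rate k n0 lam s.
have v0 l : v l != 0 by rewrite gt_eqF// out_rate_gt0.
have -> : \prod_(l < n | (0 < l)%N) mu lam k n0 l = \prod_(1 <= l < n.-1.+1) v l.
  rewrite (eq_bigr (fun l : 'I_n => v l)); last first.
    by move=> l _; exact: mu_path_rate.
  rewrite -(big_mkord (fun l => (0 < l)%N) v) prednK// big_ltn_cond//=.
  by rewrite [LHS]big_nat_cond [RHS]big_nat_cond; apply: eq_bigl => -[|l];
    rewrite ?andbT.
have termE i : series_term a lam k n0 (row_of m s) t i =
    power_term a t i * ((-1) ^+ i * exponent_sum v n.-1 i).
  rewrite /series_term -(exponent_sum_fsbig _ _ n0') /power_term (exprNn (t `^ a)).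
  rewrite (_ : \sum_(y \in Omega _ i) _ =
      \sum_(y \in Omega n i) \prod_(l < n) v l ^+ y ord0 l); last first.
    apply: eq_fsbigr => y _; apply: eq_bigr => l _.
    by congr (_ ^+ _); exact: mu_path_rate.
  by rewrite -!mulrA mulrCA; congr (_ * _); rewrite mulrCA.
rewrite mulr_sumr.
transitivity (\sum_(n.-1 <= i < N) path_coef k n0 lam s i * power_term a t i).
  apply: eq_bigr => i _; rewrite termE mulrCA mulrC; congr (_ * _).
  by rewrite hcoefE// /path_coef -cL.
rewrite /path_partial.
have [nN|Nn] := leqP n.-1 N.
  rewrite [RHS](big_cat_nat (n := n.-1))//= [X in _ = X + _]big1_seq ?add0r// => i.
  rewrite mem_index_iota => /andP[_ /andP[_ ir]].
  by rewrite /path_coef -cL hcoef_small// mul0r.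
rewrite big_geq; last exact: ltnW.
rewrite big1_seq// => i; rewrite mem_index_iota => /andP[_ /andP[_ ir]].
by rewrite /path_coef -cL hcoef_small ?mul0r// (ltn_trans ir).
Qed.

Lemma path_cvg_distinct m s t : (0 < m)%N -> s \in jumps k m -> 0 <= t ->
  injective (fun l : 'I_#|Lambda (row_of m s)| => mu lam k n0 l) ->
  path_partial s t N @[N --> \oo] -->
    \sum_(i < #|Lambda (row_of m s)|) mittag_leffler a (- mu lam k n0 i * t `^ a) /
      \prod_(l < #|Lambda (row_of m s)| | l != i) (mu lam k n0 l - mu lam k n0 i).
Proof.
move=> m0 sj t0; have cL := card_Lambda m0 sj; have muE := mu_path_rate _ m0 sj.
pose v := path_rate k n0 lam s.
move: cL muE; move: (mu lam k n0 (x := row_of m s)); set n := #|_|.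
move=> w cL wE w_inj.
have wv (l : 'I_n) : w l = v l := wE l.
have n0' : (0 < n)%N by rewrite cL /visited size_rcons.
have vinj : {in gtn n &, injective v}.
  move=> x y; rewrite !unfold_in /= => xn yn.
  rewrite -(wv (Ordinal xn)) -(wv (Ordinal yn)) => /w_inj.
  by move/(congr1 val).
pose d (l : 'I_n) := \prod_(p < n | p != l) (w p - w l)^-1.
have pcE i : path_coef k n0 lam s i = \sum_(l < n) d l * (- w l) ^+ i.
  rewrite /path_coef -cL hcoef_divided_difference ?prednK// /divided_difference.
  have -> : iota 0 n = index_iota 0 n by rewrite /index_iota subn0.
  rewrite big_map big_mkord.
  apply: eq_bigr => l _; rewrite mulrC wv; congr (_ * _).
  rewrite big_map big_mkord.
  apply: eq_big => [p|p _]; last by rewrite !wv.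
  by rewrite -/v -!wv (inj_eq w_inj).
have -> : path_partial s t = fun N => \sum_(l < n) d l *
    \sum_(0 <= i < N) (- w l) ^+ i * power_term a t i.
  apply/funext => N; rewrite /path_partial.
  under eq_bigr do rewrite pcE mulr_suml.
  rewrite exchange_big/=; apply: eq_bigr => l _.
  by rewrite mulr_sumr; apply: eq_bigr => i _; rewrite -mulrA.
apply: cvg_sum_seq => l _.
rewrite mulrC -prodfV.
by apply: cvgM; [exact: cvg_cst|exact: mittag_leffler_cvg].
Qed.

End path.

Section process.
Variables (d : measure_display) (T : measurableType d) (P : probability T R).
Variables (X : R -> T -> option nat) (k n0 : nat) (a : R) (lam : nat -> nat -> R).
Hypothesis ha : 0 < a <= 1.
Hypothesis hX : is_GFBP P k n0 a lam X.

Let q m t := state_prob P X (n0 + m)%N t.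

Lemma norm_state_prob_le1 m t : 0 <= t -> `|q m t| <= 1.
Proof.
move=> t0; have [mX _ _ _ _] := hX.
have mA := mX t (n0 + m)%N t0.
rewrite /q /state_prob ger0_norm ?fine_ge0//.
rewrite -lee_fin fineK; first exact: probability_le1.
by apply: fin_num_measure.
Qed.

Lemma state_prob_measurable m t : measurable_fun (`]0, t[ : set R) (q m).
Proof.
have [_ dX _ _ _] := hX.
apply: open_continuous_measurable_fun; first exact: interval_open.
move=> x; rewrite inE/= in_itv/= => /andP[x0 _].
apply/differentiable_continuous/derivable1_diffP.
by have [_ dp _] := dX (n0 + m)%N (leq_addr _ _); exact: dp.
Qed.

(** Jumps that would come from below the initial state carry probability 0, so
    the system only involves the states above it. *)
Lemma state_prob_volterra m t : 0 <= t ->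
  q m t = (m == 0%N)%:R +
    frac_integral a (fun s => \sum_(j < m.+1) generator k n0 lam m j * q j s) t.
Proof.
have [_ dX eqX [p0 p00] pn] := hX; move=> t0.
have -> : (m == 0%N)%:R = q m 0.
  rewrite /q; case: m => [|m]; first by rewrite addn0 p0.
  by rewrite p00// -[X in (X < _)%N]addn0 ltn_add2l.
apply: caputo_volterra => //; first exact: dX _ (leq_addr _ _).
  move=> s s0; rewrite eqX ?leq_addr// (generator_sum k n0 lam m (fun j => q j s)).
  congr (_ * _ + _).
  have le : ((minn m k).+1 <= (minn (n0 + m) k).+1)%N.
    by rewrite ltnS leq_min geq_minr andbT (leq_trans (geq_minl _ _))// leq_addl.
  rewrite (big_cat_nat (n := (minn m k).+1))//=.
  rewrite [X in _ + X]big1_seq ?addr0; last first.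
    move=> i; rewrite mem_index_iota => /andP[_ /andP[i1 i2]].
    rewrite (pn (n0 + m - i)%N) ?mulr0 ?ltW//.
    by move: i1 i2; rewrite !ltnS leq_min => ?; lia.
  rewrite !big_nat; apply: eq_bigr => i /andP[i1 i2].
  by rewrite /q addnBA//; move: i2; rewrite ltnS leq_min => /andP[].
move=> s s0; apply: bounded_mfun_sum => j; apply: bounded_mfunZ.
split; first exact: state_prob_measurable.
exists 1 => r; rewrite in_itv/= => /andP[r0 _].
by apply: norm_state_prob_le1; exact: ltW.
Qed.

Lemma state_prob_cvg m t : 0 <= t ->
  system_partial_sum (generator k n0 lam) (fun m => (m == 0%N)%:R) a t N m @[N --> \oo] --> q m t.
Proof.
move: m t; apply: system_power_series_cvg; first by case/andP: ha.
- by move=> m t; exact: norm_state_prob_le1.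
- by move=> m t; exact: state_prob_measurable.
- by move=> m t; exact: state_prob_volterra.
Qed.

End process.

End assembly.

Theorem theorem2p2 (R : realType) (d : measure_display) (T : measurableType d)
    (P : probability T R) (X : R -> T -> option nat)
    (k n0 : nat) (a : R) (lam : nat -> nat -> R)
    (hk : (1 <= k)%N) (ha : 0 < a <= 1)
    (hlam : forall n i, (n0 <= n)%N -> (1 <= i <= k)%N -> 0 < lam n i)
    (hlam0 : forall n, (n0 <= n)%N -> lam n 0%N = 1)
    (hX : is_GFBP P k n0 a lam X) :
  let p := state_prob P X in
  [/\ forall t : R, 0 <= t ->
        p n0 t =
          mittag_leffler a (- (\sum_(1 <= i < k.+1) lam n0 i) * t `^ a),
      forall (m : nat) (t : R), (1 <= m)%N -> 0 <= t ->
        (forall x : 'rV[nat]_m, Theta_range m k x ->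
           cvgn (fun N => \sum_(#|Lambda x|.-1 <= i < N)
                            series_term a lam k n0 x t i)) /\
        p (n0 + m)%N t =
          \sum_(x \in Theta_range m k)
            (\prod_(j < m) lam (n0 + j)%N (x 0 j)) *
            ((-1) ^+ #|Lambda x|.-1 /
               \prod_(l < #|Lambda x| | (0 < l)%N) mu lam k n0 l) *
            limn (fun N => \sum_(#|Lambda x|.-1 <= i < N)
                             series_term a lam k n0 x t i) &
      forall m, (1 <= m)%N ->
        (forall x : 'rV[nat]_m, Theta_range m k x ->
           injective (fun l : 'I_#|Lambda x| => mu lam k n0 l)) ->
        forall t : R, 0 <= t ->
          p (n0 + m)%N t =
            \sum_(x \in Theta_range m k)
              (\prod_(j < m) lam (n0 + j)%N (x 0 j)) *
              \sum_(i < #|Lambda x|)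
                 mittag_leffler a (- mu lam k n0 i * t `^ a) /
                 \prod_(l < #|Lambda x| | l != i)
                    (mu lam k n0 l - mu lam k n0 i)].
Proof.
have /andP[a0 _] := ha.
have expansion m t (L : seq nat -> R) : 0 <= t ->
    (forall s, s \in jumps k m -> path_partial k n0 lam a s t N @[N --> \oo] --> L s) ->
    state_prob P X (n0 + m)%N t = \sum_(s <- jumps k m) path_weight n0 lam s * L s.
  move=> t0 HL; have pc := @state_prob_cvg _ _ _ _ _ _ _ _ _ ha hX m t t0.
  rewrite -(cvg_lim _ pc)//; apply/cvg_lim => //.
  have -> : (fun N => system_partial_sum (generator k n0 lam) (fun m => (m == 0%N)%:R) a t N m) =
     fun N => \sum_(s <- jumps k m) path_weight n0 lam s * path_partial k n0 lam a s t N.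
    apply/funext => N; rewrite /system_partial_sum.
    under eq_bigr do rewrite -path_sum// mulr_suml.
    rewrite exchange_big/=; apply: eq_bigr => s _.
    by rewrite /path_partial mulr_sumr; apply: eq_bigr => i _; rewrite mulrA.
  by apply: cvg_sum_seq => s sj; apply: cvgM; [exact: cvg_cst|exact: HL].
have weightE m s : s \in jumps k m ->
    \prod_(j < m) lam (n0 + j)%N (row_of m s 0 j) = path_weight n0 lam s.
  move=> sj; rewrite /path_weight (size_jumps sj).
  by apply: eq_bigr => j _; rewrite mxE.
move=> p; split.
- move=> t t0.
  have h1 := @state_prob_cvg _ _ _ _ _ _ _ _ _ ha hX 0 t t0.
  have h2 := @mittag_leffler_cvg _ a t (\sum_(1 <= i < k.+1) lam n0 i) a0 t0.
  rewrite addn0 in h1; apply: (cvg_unique _ h1) => //.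
  apply: cvg_trans h2; apply: near_eq_cvg; apply: nearW => N.
  apply: eq_bigr => i _; congr (_ * _).
  elim: i => // i IH; rewrite exprS IH /= big_ord1 /generator eqxx /out_rate.
  by rewrite addn0.
- move=> m t m1 t0; rewrite Theta_rangeE//.
  have K0 (s : seq nat) : s \in jumps k m ->
     ((-1) ^+ #|Lambda (row_of m s)|.-1 /
     \prod_(l < #|Lambda (row_of m s)| | (0 < l)%N) mu lam k n0 l) != 0.
    move=> sj; rewrite mulf_neq0 ?signr_eq0// invr_eq0.
    apply/prodf_neq0 => l _; rewrite (mu_path_rate _ _ _ m1 sj).
    by rewrite gt_eqF// out_rate_gt0.
  have tailE s : s \in jumps k m ->
      (fun N => \sum_(#|Lambda (row_of m s)|.-1 <= i < N) series_term a lam k n0 (row_of m s) t i) =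
      (fun N => ((-1) ^+ #|Lambda (row_of m s)|.-1 /
     \prod_(l < #|Lambda (row_of m s)| | (0 < l)%N) mu lam k n0 l)^-1 *
        path_partial k n0 lam a s t N).
    move=> sj; apply/funext => N.
    by rewrite -(series_term_path hk hlam a t N m1 sj) mulKf//; exact: K0.
  have cv s : s \in jumps k m -> cvgn (fun N => \sum_(#|Lambda (row_of m s)|.-1 <= i < N)
      series_term a lam k n0 (row_of m s) t i).
    move=> sj; rewrite tailE//; apply: is_cvgM; first exact: is_cvg_cst.
    exact: is_cvg_path.
  split; first by move=> x /= /mapP[s sj ->]; exact: cv.
  rewrite fsbig_row_of ?uniq_jumps//; last exact: size_jumps.
  rewrite /p (expansion m t (fun s => limn (path_partial k n0 lam a s t)))//; last first.
    by move=> s sj; exact: is_cvg_path.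
  rewrite !big_seq; apply: eq_bigr => s sj.
  rewrite weightE// -mulrA; congr (_ * _).
  rewrite tailE// limM; [|exact: is_cvg_cst|exact: is_cvg_path].
  by rewrite lim_cst// mulVKf// K0.
- move=> m m1; rewrite Theta_rangeE// => inj t t0.
  rewrite fsbig_row_of ?uniq_jumps//; last exact: size_jumps.
  rewrite /p (expansion m t (fun s => \sum_(i < #|Lambda (row_of m s)|)
     mittag_leffler a (- mu lam k n0 i * t `^ a) /
      \prod_(l < #|Lambda (row_of m s)| | l != i) (mu lam k n0 l - mu lam k n0 i)))//.
    by rewrite !big_seq; apply: eq_bigr => s sj; rewrite weightE.
  move=> s sj; apply: path_cvg_distinct => //.
  by apply: inj => /=; apply/mapP; exists s.
Qed.
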